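(* Let $u$ be the solution of the parabolic problem (P) described in the context and let $u_h\in C^1([0,T];S_h)$ be its semidiscrete approximation, i.e. $u_h(0,\cdot)=R_hu_0$ and, for all $\chi\in S_h$ and $t\in[0,T]$, $$(\partial_tu_h(t,\cdot),\chi)=\big[\varepsilon(t)\,\partial_tu_h(t,1)+\delta(t)\,u_h(t,1)+g(t)\big]\chi(1)-a(t)\,\mathcal B(u_h(t,\cdot),\chi)+(\beta(t,\cdot)u_h(t,\cdot),\chi)+(f(t,\cdot),\chi).$$ If $\varepsilon(t)\le0$ for $t\in[0,T]$, then there is a constant $C$, independent of $h$ and $t$, such that for all $h\in(0,h_\star]$ $$\|u_h(t,\cdot)-u(t,\cdot)\|+h\,\|u_h(t,\cdot)-u(t,\cdot)\|_1\le C\,h^{r+1}\Big[\|u(t,\cdot)\|_{r+1}+\Big(\int_0^t\Gamma_D(\tau)\,d\tau\Big)^{1/2}\Big]\qquad\forall\,t\in[0,T],$$ where $\Gamma_D(\tau):=\|u(\tau,\cdot)\|_{r+1}^2+\|\partial_tu(\tau,\cdot)\|_{r+1}^2$.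
   Context: Function spaces: $D=(0,1)$; functions are real-valued; $(f_1,f_2)=\int_Df_1f_2\,dx$ and $\|\cdot\|$ is the $L^2(D)$ norm; $\|f\|_s=\big(\sum_{\ell=0}^s\|\partial_x^\ell f\|^2\big)^{1/2}$ is the norm of $H^s(D)$; $\mathbb H^1(D)=\{v\in H^1(D):v(0)=0\}$, $\mathbb H^s(D)=H^s(D)\cap\mathbb H^1(D)$ for $s\ge2$; $\mathcal B(v,w)=(v',w')$. Finite elements: $r\in\mathbb N$, $h_\star>0$ are fixed. For each $h\in(0,h_\star]$, $S_h$ is a finite-dimensional subspace of $\mathbb H^1(D)$ consisting of real-valued functions that are polynomials of degree at most $r$ on each interval of a (non-uniform) partition of $D$ with maximum length $h$ (in particular the function $x\mapsto x$ is in $S_h$). With a constant independent of $h$, $\inf_{\chi\in S_h}\{\|v-\chi\|+h\|v-\chi\|_1\}\le C h^{s+1}\|v\|_{s+1}$ for $v\in\mathbb H^{s+1}(D)$, $s=0,\dots,r$. (No inverse inequality is assumed.) The elliptic projection $R_h:H^1(D)\to S_h$ is defined by $\mathcal B(R_hv,\phi)=\mathcal B(v,\phi)$ for all $\phi\in S_h$. Problem (P): $T>0$; $\beta,f:[0,T]\times[0,1]\to\mathbb R$, $\delta,g,\varepsilon:[0,T]\to\mathbb R$, $a:[0,T]\to(0,\infty)$ with $\inf_{[0,T]}a>0$, $u_0:[0,1]\to\mathbb R$ are given smooth functions; $u:[0,T]\times[0,1]\to\mathbb R$ satisfies $u_t=a(t)u_{xx}+\beta(t,x)u+f(t,x)$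 on $[0,T]\times[0,1]$; $u(t,0)=0$ and $a(t)u_x(t,1)=\varepsilon(t)u_t(t,1)+\delta(t)u(t,1)+g(t)$ for $t\in[0,T]$; $u(0,x)=u_0(x)$ for $x\in[0,1]$. The solution $u$ is assumed sufficiently smooth for the stated estimate. *)

(* Defs.v *)
From HB Require Import structures.
From mathcomp Require Import all_boot all_order all_algebra.
From mathcomp Require Import all_classical all_reals all_analysis.

Set Implicit Arguments.
Unset Strict Implicit.
Unset Printing Implicit Defensive.

Import Order.TTheory GRing.Theory Num.Theory.
Import numFieldNormedType.Exports.

Local Open Scope classical_set_scope.
Local Open Scope ring_scope.

(* Functions on D = (0,1), [0,1] or [0,T] are total functions on R. Every
   notion below only looks at the values on the relevant interval. *)

Section SobolevSpaces.
Variable R : realType.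
Implicit Types (v w g phi : R -> R) (s : nat).

Local Notation mu := (@lebesgue_measure R).

Definition D01 : set R := `]0, 1[.

Definition L2 : set (R -> R) :=
  [set v : R -> R | measurable_fun D01 v /\
                       mu.-integrable D01 (fun x => ((v x) ^+ 2)%:E)].

Definition ip v w : R := \int[mu]_(x in D01) (v x * w x).

Definition L2norm v : R := Num.sqrt (ip v v).

Definition test_function phi : Prop :=
  [/\ forall x, derivable phi x 1,
      continuous (derive1 phi) &
      exists a b : R, [/\ 0 < a, b < 1 & forall x, x \notin `[a, b] -> phi x = 0]].

(* In one dimension, testing against C^1_c(D) or against C^oo_c(D) is the same;
   C^1_c(D) is the choice of Brezis, Functional Analysis, Section 8.2. *)
Definition is_weak_deriv v g : Prop :=
  L2 g /\ forall phi, test_function phi -> ip v (derive1 phi) = - ip g phi.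

(* Weak derivatives are unique up to null sets only: this selects one, and is
   the zero function when v has none in L^2(D). *)
Definition wderiv v : R -> R := xget (fun=> 0) [set g | is_weak_deriv v g].

Definition wderivn (l : nat) v : R -> R := iter l wderiv v.

(* H^s(D) *)
Definition Hs s : set (R -> R) :=
  [set v : R -> R | L2 v /\
           forall l, (l < s)%N -> is_weak_deriv (wderivn l v) (wderivn l.+1 v)].

Definition Hnorm s v : R :=
  Num.sqrt (\sum_(l < s.+1) (L2norm (wderivn l v)) ^+ 2).

(* The functions of H^s(D), s >= 1, that vanish at 0. Point values of an element
   of H^1(D) are those of its continuous representative, so v is required to be
   that representative. *)
Definition HH s : set (R -> R) :=
  [set v : R -> R | [/\ Hs s v, {within `[0, 1], continuous v} & v 0 = 0]].

Definition B v w : R := ip (wderiv v) (wderiv w).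

End SobolevSpaces.

Section FiniteElements.
Variable R : realType.
Implicit Types (V : set (R -> R)) (v p : R -> R) (r : nat).

(* V is the span, as functions on [0,1], of a finite family. *)
Definition finite_dim_subspace V : Prop :=
  exists (n : nat) (b : 'I_n -> R -> R),
    V = [set chi | exists c : 'I_n -> R,
           forall x, x \in `[0, 1] -> chi x = \sum_i c i * b i x].

(* A partition 0 = x_0 < x_1 < ... < x_J = 1 is coded by s = [:: x_1; ...; x_J],
   so that its i-th interval is ](0 :: s)`_i, s`_i[. *)
Definition mesh_size (s : seq R) : R :=
  \big[Num.max/0]_(i < size s) (s`_i - (0 :: s)`_i).

Definition piecewise_poly r (s : seq R) v : Prop :=
  forall i : nat, (i < size s)%N ->
    exists2 q : {poly R}, (size q <= r.+1)%N &
      forall x, x \in `](0 :: s)`_i, s`_i[ -> v x = q.[x].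

Definition fe_space r (h : R) V : Prop :=
  [/\ finite_dim_subspace V,
      V `<=` HH 1,
      exists s : seq R, [/\ itv_partition 0 1 s, mesh_size s = h &
        forall chi, V chi -> piecewise_poly r s chi] &
      V id].

Definition best_approx (h : R) V v : R :=
  inf [set L2norm (v \- chi) + h * Hnorm 1 (v \- chi) | chi in V].

Definition fe_family r (hstar : R) (S : R -> set (R -> R)) : Prop :=
  (forall h, 0 < h <= hstar -> fe_space r h (S h)) /\
  exists C : R, forall h, 0 < h <= hstar ->
    forall s : nat, (s <= r)%N -> forall v, HH s.+1 v ->
      best_approx h (S h) v <= C * h ^+ s.+1 * Hnorm s.+1 v.

Definition is_elliptic_projection V v p : Prop :=
  V p /\ forall phi, V phi -> B p phi = B v phi.

End FiniteElements.

Section Smoothness.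
Variable R : realType.
Implicit Types (A : set R) (v : R -> R) (T : R) (F : R -> R -> R).

Definition diff_quot v (t s : R) : R := (v s - v t) / (s - t).

(* Derivative relative to A; one-sided at the endpoints when A = `[a, b]. *)
Definition derive_in A v (t : R) : R :=
  lim (diff_quot v t @ within A t^').

Definition derivable_in A v (t : R) : Prop :=
  cvg (diff_quot v t @ within A t^').

(* C^oo on A, up to the boundary *)
Definition smooth_on A v : Prop :=
  forall n : nat, {within A, continuous (iter n (derive_in A) v)} /\
    forall t, A t -> derivable_in A (iter n (derive_in A) v) t.

(* Partial derivatives of F(t,x) on [0,T] x [0,1] *)
Definition dt T F : R -> R -> R :=
  fun t x => derive_in `[0, T] (fun s => F s x) t.

Definition dx F : R -> R -> R :=
  fun t => derive_in `[0, 1] (F t).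

Definition dtx T (i j : nat) F : R -> R -> R := iter i (dt T) (iter j dx F).

(* The mixed derivatives of F of order at most m in t and at most n in x exist,
   are continuous on the closed rectangle, and do not depend on the order of
   differentiation. *)
Definition C_tx T (m n : nat) F : Prop :=
  forall i j : nat, (i <= m)%N -> (j <= n)%N ->
  [/\ {within `[0, T] `*` `[0, 1],
         continuous (fun p : R * R => dtx T i j F p.1 p.2)},
      (i < m)%N -> forall t x, t \in `[0, T] -> x \in `[0, 1] ->
        derivable_in `[0, T] (fun s => dtx T i j F s x) t &
      (j < n)%N -> forall t x, t \in `[0, T] -> x \in `[0, 1] ->
        diff_quot (dtx T i j F t) x @ within `[0, 1] x^' --> dtx T i j.+1 F t x].

Definition smooth_tx T F : Prop := forall m n : nat, C_tx T m n F.

End Smoothness.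

Section Problem.
Variable R : realType.
Implicit Types (T : R) (beta f u : R -> R -> R) (delta g eps a : R -> R).

Definition data_P T beta f delta g eps a (u0 : R -> R) : Prop :=
  [/\ 0 < T,
      smooth_tx T beta /\ smooth_tx T f,
      [/\ smooth_on `[0, T] delta, smooth_on `[0, T] g & smooth_on `[0, T] eps],
      [/\ smooth_on `[0, T] a, forall t, t \in `[0, T] -> 0 < a t &
          0 < inf [set a t | t in `[0, T]]] &
      smooth_on `[0, 1] u0].

Definition solves_P T beta f delta g eps a (u0 : R -> R) u : Prop :=
  [/\ forall t x, t \in `[0, T] -> x \in `[0, 1] ->
        dt T u t x = a t * dx (dx u) t x + beta t x * u t x + f t x,
      forall t, t \in `[0, T] -> u t 0 = 0,
      forall t, t \in `[0, T] ->
        a t * dx u t 1 = eps t * dt T u t 1 + delta t * u t 1 + g t &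
      forall x, x \in `[0, 1] -> u 0 x = u0 x].

(* w belongs to C^1([0,T]; V), with derivative w', for the norm of H^1(D) *)
Definition C1_path T (V : set (R -> R)) (w w' : R -> R -> R) : Prop :=
  forall t, t \in `[0, T] ->
  [/\ V (w t) /\ V (w' t),
      Hnorm 1 (fun x => (w s x - w t x) / (s - t) - w' t x)
        @[s --> within `[0, T] t^'] --> (0 : R) &
      Hnorm 1 (w' s \- w' t) @[s --> within `[0, T] (nbhs t)] --> (0 : R)].

Definition semidiscrete_solution T beta f delta g eps a (u0 : R -> R)
    (V : set (R -> R)) (w : R -> R -> R) : Prop :=
  exists w' : R -> R -> R,
  [/\ C1_path T V w w',
      is_elliptic_projection V u0 (w 0) &
      forall chi t, V chi -> t \in `[0, T] ->
        ip (w' t) chi =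
          (eps t * w' t 1 + delta t * w t 1 + g t) * chi 1
          - a t * B (w t) chi
          + ip (fun x => beta t x * w t x) chi
          + ip (f t) chi].

Definition Gamma_D T (r : nat) u (tau : R) : R :=
  (Hnorm r.+1 (u tau)) ^+ 2 + (Hnorm r.+1 (dt T u tau)) ^+ 2.

End Problem.

(* Main.v *)
Require Import Defs.
From HB Require Import structures.
From mathcomp Require Import all_boot all_order all_algebra.
From mathcomp Require Import all_classical all_reals all_analysis.
From mathcomp Require Import measurable_realfun ring lra.

Set Implicit Arguments.
Unset Strict Implicit.
Unset Printing Implicit Defensive.

Import Order.TTheory GRing.Theory Num.Theory.
Import numFieldNormedType.Exports.

Local Open Scope classical_set_scope.
Local Open Scope ring_scope.

(** The error uh - u is split as theta + eta, where p is the elliptic projection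
    of u, theta = uh - p lies in the finite element space and eta = p - u.

    The part eta is estimated by Cea's lemma in the energy norm and by a duality
    argument in L2 ([projection_error]); the projection commutes with the time
    derivative, so the same bound, with u_t for u, holds for the time derivative
    of eta.  Since x |-> x is a finite element function, eta vanishes at x = 1
    ([elliptic_projection_endpoint]), although no condition is imposed there:
    hence neither the boundary value of eta nor that of its time derivative
    enters the equation for theta ([error_equation]).

    The part theta is estimated directly in the energy norm, since no inverse
    inequality is available to pass from L2 to H1.  Testing the equation with
    the time derivative theta' gives a term eps theta'(1)^2 with a good sign,
    and every other term containing theta' is either a time derivative or is
    absorbed by the square of the L2 norm of theta' ([energy_estimate]).
    The term delta theta(1)^2 that appears in the energy is indefinite; it is
    compensated by means of the interpolation inequality [trace_interpolation].
    As theta(0) has zero energy, Gronwall's inequality yields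
    B theta theta <= C h^(2r+2) int_0^t Gamma_D, and Poincare's inequality turns
    this into the estimate of the full H1 norm.

    The two analytic tools are uniqueness of weak derivatives
    ([du_bois_reymond]), which identifies the weak derivatives of the smooth
    function u with the classical ones, and integration by parts with
    boundary terms ([weak_ibp]).  Both come from testing with C^1 cutoffs of
    an interval ([weak_deriv_ftc]). *)

(** * The inner product of L2(D) *)

Section InnerProduct.
Variable R : realType.
Implicit Types (v w z : R -> R) (k : R).
Local Notation mu := (@lebesgue_measure R).
Local Notation D := (@D01 R).

Lemma measurable_D01 : measurable D.
Proof. exact: measurable_itv. Qed.
Hint Resolve measurable_D01 : core.

Lemma integrable_addR v w : mu.-integrable D (EFin \o v) ->
  mu.-integrable D (EFin \o w) -> mu.-integrable D (EFin \o (fun x => v x + w x)).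
Proof.
move=> iv iw; exact: (@integrableD _ _ _ mu D measurable_D01 _ _ iv iw).
Qed.

Lemma integrable_scaleR k v : mu.-integrable D (EFin \o v) ->
  mu.-integrable D (EFin \o (fun x => k * v x)).
Proof.
move=> iv; exact: (@integrableZl _ _ _ mu D measurable_D01 k _ iv).
Qed.

Lemma L2_integrableM v w : L2 v -> L2 w ->
  mu.-integrable D (EFin \o (fun x => v x * w x)).
Proof.
move=> [mv iv] [mw iw].
apply: (@le_integrable _ _ _ mu D measurable_D01 _ (EFin \o (fun x => v x ^+ 2 + w x ^+ 2))).
- by apply/measurable_EFinP; exact: measurable_funM.
- move=> x _ /=; rewrite lee_fin (ger0_norm (addr_ge0 (sqr_ge0 _) (sqr_ge0 _))) ler_norml.
  by apply/andP; split; nra.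
- exact: integrable_addR.
Qed.

Lemma L2_lin k v w : L2 v -> L2 w -> L2 (fun x => k * v x + w x).
Proof.
move=> [mv iv] [mw iw]; have mk : measurable_fun D (fun x => k * v x).
  by apply: measurable_funM => //; exact: measurable_cst.
split; first exact: measurable_funD.
apply: (@le_integrable _ _ _ mu D measurable_D01 _
  (EFin \o (fun x => (2 * k ^+ 2) * v x ^+ 2 + 2 * w x ^+ 2))).
- apply/measurable_EFinP; apply: measurable_funX; exact: measurable_funD.
- move=> x _ /=; rewrite lee_fin ger0_norm ?sqr_ge0// ger0_norm.
    by have := sqr_ge0 (k * v x - w x); nra.
  by have := sqr_ge0 (k * v x); have := sqr_ge0 (w x); nra.
- by apply: integrable_addR; apply: integrable_scaleR.
Qed.

Lemma L2_0 : L2 (fun=> 0 : R).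
Proof.
split; first exact: measurable_cst.
by rewrite (_ : (fun x : R => _) = cst 0%E) ?integrable0//; apply/funext => x; rewrite expr0n.
Qed.

Lemma L2Z k v : L2 v -> L2 (fun x => k * v x).
Proof.
by move=> Lv; rewrite (_ : (fun x => _) = (fun x => k * v x + 0));
  [exact: (L2_lin k Lv L2_0)|apply/funext => x; rewrite addr0].
Qed.

Lemma L2D v w : L2 v -> L2 w -> L2 (v \+ w).
Proof.
by move=> Lv /(L2_lin 1 Lv) Lw; rewrite (_ : _ \+ _ = (fun x => 1 * v x + w x))//;
  apply/funext => x /=; rewrite mul1r.
Qed.

Lemma L2B v w : L2 v -> L2 w -> L2 (v \- w).
Proof.
by move=> Lv /(L2_lin (-1))/(_ Lv) Lw; rewrite (_ : _ \- _ = (fun x => -1 * w x + v x))//;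
  apply/funext => x /=; rewrite mulN1r addrC.
Qed.

Lemma ipC v w : ip v w = ip w v.
Proof. by apply: eq_Rintegral => x _; rewrite mulrC. Qed.

Lemma ip_linl k v w z : L2 v -> L2 w -> L2 z ->
  ip (fun x => k * v x + w x) z = k * ip v z + ip w z.
Proof.
move=> Lv Lw Lz; rewrite /ip -RintegralZl//; last exact: L2_integrableM.
rewrite -RintegralD//.
- by apply: eq_Rintegral => x _; rewrite mulrDl mulrA.
- apply: (@eq_integrable _ _ _ mu D _ (EFin \o (fun x => (k * v x) * z x))) => //.
    by move=> x _ /=; rewrite mulrA.
  by apply: L2_integrableM => //; exact: L2Z.
- exact: L2_integrableM.
Qed.

Lemma ipDl v w z : L2 v -> L2 w -> L2 z -> ip (v \+ w) z = ip v z + ip w z.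
Proof.
move=> Lv Lw Lz; rewrite -[ip v z]mul1r -ip_linl//.
by congr (ip _ z); apply/funext => x /=; rewrite mul1r.
Qed.

Lemma ipBl v w z : L2 v -> L2 w -> L2 z -> ip (v \- w) z = ip v z - ip w z.
Proof.
move=> Lv Lw Lz; rewrite addrC -mulN1r -ip_linl//.
by congr (ip _ z); apply/funext => x /=; rewrite mulN1r addrC.
Qed.

Lemma ip0l z : ip (fun=> 0) z = 0.
Proof. by rewrite /ip; under eq_Rintegral do rewrite mul0r; rewrite Rintegral_cst// mul0r. Qed.

Lemma ipZl k v z : L2 v -> L2 z -> ip (fun x => k * v x) z = k * ip v z.
Proof.
move=> Lv Lz; rewrite -[RHS]addr0 -(ip0l z) -ip_linl//; last exact: L2_0.
by congr (ip _ z); apply/funext => x; rewrite addr0.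
Qed.

Lemma ipDr v w z : L2 v -> L2 w -> L2 z -> ip z (v \+ w) = ip z v + ip z w.
Proof. by move=> *; rewrite ipC ipDl// ![ip z _]ipC. Qed.

Lemma ipBr v w z : L2 v -> L2 w -> L2 z -> ip z (v \- w) = ip z v - ip z w.
Proof. by move=> *; rewrite ipC ipBl// ![ip z _]ipC. Qed.

Lemma ipZr k v z : L2 v -> L2 z -> ip z (fun x => k * v x) = k * ip z v.
Proof. by move=> *; rewrite ipC ipZl// ipC. Qed.

Lemma ip_ge0 v : 0 <= ip v v.
Proof. by apply: Rintegral_ge0 => x _; rewrite -expr2 sqr_ge0. Qed.

Lemma L2norm_ge0 v : 0 <= L2norm v.
Proof. exact: sqrtr_ge0. Qed.

Lemma sqr_L2norm v : L2norm v ^+ 2 = ip v v.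
Proof. by rewrite sqr_sqrtr// ip_ge0. Qed.

(** The quadratic polynomial k |-> ip (k v + w) (k v + w) is nonnegative. When
    ip v v = 0 it is affine in k, hence constant. *)
Lemma ip_CS v w : L2 v -> L2 w -> `|ip v w| <= L2norm v * L2norm w.
Proof.
move=> Lv Lw; rewrite -ler_sqr ?nnegrE ?mulr_ge0 ?L2norm_ge0//.
rewrite real_normK ?num_real// exprMn !sqr_L2norm.
have key k : 0 <= k ^+ 2 * ip v v + 2 * k * ip v w + ip w w.
  have := ip_ge0 (fun x => k * v x + w x).
  have Ll := L2_lin k Lv Lw.
  rewrite ip_linl// (ipC v) (ipC w) !ip_linl// (ipC w v) => /le_trans; apply.
  by rewrite le_eqVlt; apply/orP; left; apply/eqP; ring.
have [v0|v0] := eqVneq (ip v v) 0; last first.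
  have vp : 0 < ip v v by rewrite lt_neqAle eq_sym v0 ip_ge0.
  have := key (- (ip v w / ip v v)).
  rewrite (_ : _ + _ = ip w w - ip v w ^+ 2 / ip v v); last by field.
  by rewrite subr_ge0 ler_pdivrMr// mulrC.
rewrite v0 mul0r.
have [->|vw0] := eqVneq (ip v w) 0; first by rewrite expr0n.
have := key (- (ip w w + 1) / (2 * ip v w)).
rewrite v0 (_ : _ + _ = -1); last by field.
by rewrite lerNr oppr0 ler10.
Qed.

Lemma ip_le v w : L2 v -> L2 w -> ip v w <= L2norm v * L2norm w.
Proof. by move=> Lv Lw; apply: le_trans (ip_CS Lv Lw); exact: ler_norm. Qed.

Lemma L2normD v w : L2 v -> L2 w -> L2norm (v \+ w) <= L2norm v + L2norm w.
Proof.
move=> Lv Lw; rewrite -ler_sqr ?nnegrE ?addr_ge0 ?L2norm_ge0//.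
rewrite sqr_L2norm ipDl ?ipDr//; [|exact: L2D..].
rewrite sqrrD !sqr_L2norm [ip w v]ipC.
have := ip_le Lv Lw; lra.
Qed.

Lemma L2normZ k v : L2 v -> L2norm (fun x => k * v x) = `|k| * L2norm v.
Proof.
move=> Lv; rewrite /L2norm ipZl ?ipZr//; last exact: L2Z.
by rewrite mulrA -expr2 sqrtrM ?sqr_ge0// sqrtr_sqr.
Qed.

Lemma L2normN v w : L2norm (v \- w) = L2norm (w \- v).
Proof. by congr Num.sqrt; apply: eq_Rintegral => x _ /=; ring. Qed.

Lemma ae_eq_ip v v' w w' : L2 v -> L2 v' -> L2 w -> L2 w' ->
  ae_eq mu D v v' -> ae_eq mu D w w' -> ip v w = ip v' w'.
Proof.
move=> [mv _] [mv' _] [mw _] [mw' _] vv' ww'; rewrite /ip /Rintegral; congr fine.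
apply: ae_eq_integral => //.
- by apply/measurable_EFinP; exact: measurable_funM.
- by apply/measurable_EFinP; exact: measurable_funM.
- by apply: filterS2 vv' ww' => x e1 e2 Dx; rewrite e1// e2.
Qed.

Lemma ae_eq_L2norm v v' : L2 v -> L2 v' -> ae_eq mu D v v' -> L2norm v = L2norm v'.
Proof. by move=> Lv Lv' vv'; rewrite /L2norm (@ae_eq_ip v v' v v'). Qed.

Lemma eq_ip v v' w w' : {in D, v =1 v'} -> {in D, w =1 w'} -> ip v w = ip v' w'.
Proof. by move=> e1 e2; apply: eq_Rintegral => x Dx; rewrite e1 ?e2. Qed.

Lemma D01_cc : D `<=` `[0, 1].
Proof. by move=> x; rewrite /D01 /= !in_itv/= => /andP[/ltW -> /ltW ->]. Qed.

Lemma L2_continuous v : {within `[0, 1], continuous v} -> L2 v.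
Proof.
move=> cv; split.
  apply: (measurable_funS _ D01_cc); first exact: measurable_itv.
  by apply: subspace_continuous_measurable_fun => //; exact: measurable_itv.
apply: (@integrableS _ _ _ mu `[0, 1]%classic) => //; first exact: D01_cc.
apply: continuous_compact_integrable; first exact: segment_compact.
by move=> x; apply: continuousM; exact: cv.
Qed.

Lemma Rintegral_D01_cst (c : R) : \int[mu]_(x in D) c = c.
Proof.
have e : lebesgue_measure ([set` `]0, 1[%R] : set R) = 1%E.
  by rewrite lebesgue_measure_itv/= lte_fin ltr01 oppr0 adde0.
by rewrite Rintegral_cst// [X in fine X]e mulr1.
Qed.

Lemma ler_sqr_norm (x c : R) : `|x| <= c -> x ^+ 2 <= c ^+ 2.
Proof. by move=> xc; rewrite -real_normK ?num_real// lerXn2r// ?nnegrE// (le_trans _ xc). Qed.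

Lemma L2norm_le_bound v (c : R) : 0 <= c -> L2 v ->
  (forall x, D x -> `|v x| <= c) -> L2norm v <= c.
Proof.
move=> c0 Lv vc; rewrite -ler_sqr ?nnegrE ?L2norm_ge0// sqr_L2norm.
rewrite -[leRHS]Rintegral_D01_cst.
apply: le_Rintegral => //.
- exact: L2_integrableM.
- by apply: L2_integrableM => //; apply: L2_continuous => x; exact: cvg_cst.
- by move=> x Dx; rewrite -expr2; exact: ler_sqr_norm (vc x Dx).
Qed.

Lemma L2_mul_bounded v w (c : R) : L2 v -> measurable_fun D w ->
  (forall x, D x -> `|w x| <= c) -> L2 (fun x => w x * v x).
Proof.
move=> [mv iv] mw wc; split; first exact: measurable_funM.
apply: (@le_integrable _ _ _ mu D measurable_D01 _ (EFin \o (fun x => c ^+ 2 * v x ^+ 2))).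
- by apply/measurable_EFinP; apply: measurable_funX; exact: measurable_funM.
- move=> x Dx /=; rewrite lee_fin (ger0_norm (sqr_ge0 _)).
  apply: le_trans (ler_norm _); rewrite exprMn; apply: ler_wpM2r (sqr_ge0 _) _ _ _.
  exact: ler_sqr_norm (wc x Dx).
- exact: integrable_scaleR.
Qed.

Lemma L2norm_mul_bounded v w (c : R) : L2 v -> measurable_fun D w -> 0 <= c ->
  (forall x, D x -> `|w x| <= c) -> L2norm (fun x => w x * v x) <= c * L2norm v.
Proof.
move=> Lv mw c0 wc; rewrite -ler_sqr ?nnegrE ?mulr_ge0 ?L2norm_ge0// exprMn !sqr_L2norm.
have Lw := L2_mul_bounded Lv mw wc.
rewrite /ip -RintegralZl//; last exact: L2_integrableM.
apply: le_Rintegral => //; first exact: L2_integrableM.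
- by apply: integrable_scaleR; exact: L2_integrableM.
- move=> x Dx; rewrite (_ : _ * _ = w x ^+ 2 * (v x * v x)); last by ring.
  rewrite -expr2; apply: ler_wpM2r (sqr_ge0 _) _ _ _; exact: ler_sqr_norm (wc x Dx).
Qed.

End InnerProduct.
#[global] Hint Resolve measurable_D01 : core.
Arguments measurable_D01 {R}.

(** * Continuously differentiable cutoff functions *)

Section Cutoffs.
Variable R : realType.
Local Notation mu := (@lebesgue_measure R).
Local Notation D := (@D01 R).
Implicit Types (v g : R -> R) (x y a b c s : R) (n : nat).

Definition ramp y : R := Num.max 0 y.

(** The first-order remainder of the squared positive part is at most h^2, also
    across the kink at 0. *)
Lemma sqr_ramp_is_derive y : is_derive y 1 (fun x => ramp x ^+ 2) (2 * ramp y).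
Proof.
have lim : h^-1 *: (ramp (h + y) ^+ 2 - ramp y ^+ 2) @[h --> 0^'] --> 2 * ramp y.
  apply/cvgrPdist_le => e e0; near=> h.
  have h0 : h != 0 by near: h; exact: nbhs_dnbhs_neq.
  have he : `|h| <= e.
    near: h; apply: dnbhs0_le; exact: e0.
  apply: le_trans he; rewrite -(@ler_pM2r _ `|h|) ?normr_gt0// -normrM mulrBl.
  have -> : h^-1 *: (ramp (h + y) ^+ 2 - ramp y ^+ 2) * h = ramp (h + y) ^+ 2 - ramp y ^+ 2.
    by rewrite /GRing.scale/= mulrAC mulVf// mul1r.
  rewrite -expr2 real_normK ?num_real// ler_norml /ramp /Num.max.
  by case: ltP => ?; case: ltP => ?; apply/andP; split; nra.
apply: DeriveDef.
- by apply/cvg_ex; exists (2 * ramp y); under eq_fun do rewrite /= [_%:A]mulr1.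
- by apply/cvg_lim => //; under eq_fun do rewrite /= [_%:A]mulr1.
Unshelve. all: by end_near. Qed.

Lemma ramp_continuous : continuous ramp.
Proof.
move=> x; apply: (@continuous_max _ _ (fun=> 0) id) => //; exact: cvg_cst.
Qed.

(** A second difference of the squared positive part: it is C^1, vanishes on
    the negative half-line, equals 1 from 1 on, and has the piecewise affine
    derivative hat. *)
Definition smoothstep y := 2 * (ramp y ^+ 2 - 2 * ramp (y - 2^-1) ^+ 2 + ramp (y - 1) ^+ 2).
Definition hat y := 4 * (ramp y - 2 * ramp (y - 2^-1) + ramp (y - 1)).

Lemma smoothstep_is_derive y : is_derive y 1 smoothstep (hat y).
Proof.
have H c : is_derive y 1 (fun x => ramp (x - c) ^+ 2) (2 * ramp (y - c)).
  have := @is_derive1_comp _ (fun x => ramp x ^+ 2) (fun x => x - c) y _ _ (sqr_ramp_is_derive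
    (y - c)) (is_deriveB (is_derive_id y 1) (is_derive_cst c y 1)).
  by rewrite subr0 mulr1.
have := H 0; rewrite subr0 (_ : (fun x => ramp (x - 0) ^+ 2) = (fun x => ramp x ^+ 2)); last first.
  by apply/funext => x; rewrite subr0.
move=> H0.
have := is_deriveZ 2 (is_deriveD (is_deriveB H0 (is_deriveZ 2 (H 2^-1))) (H 1)).
move=> H2; rewrite (_ : hat y = 2 * (2 * ramp y - 2 * (2 * ramp (y - 2^-1)) + 2 * ramp (y - 1))).
  exact: H2.
by rewrite /hat; ring.
Qed.

Lemma hat_continuous : continuous hat.
Proof.
have H c : continuous (fun x => ramp (x - c)).
  move=> x; apply: (@continuous_comp _ _ _ (fun x => x - c) ramp); last exact: ramp_continuous.
  by apply: cvgB; [exact: cvg_id|exact: cvg_cst].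
move=> x; apply: cvgM; first exact: cvg_cst.
apply: cvgD; last exact: H.
apply: cvgB; first exact: ramp_continuous.
apply: cvgM; [exact: cvg_cst|exact: H].
Qed.

Lemma smoothstep_le0 y : y <= 0 -> smoothstep y = 0.
Proof. by rewrite /smoothstep /ramp /Num.max => y0; do !case: ltP => ?; lra. Qed.

Lemma smoothstep_ge1 y : 1 <= y -> smoothstep y = 1.
Proof. by rewrite /smoothstep /ramp /Num.max => y0; do !case: ltP => ?; nra. Qed.

Lemma hat_out y : y <= 0 \/ 1 <= y -> hat y = 0.
Proof. by rewrite /hat /ramp /Num.max => y0; do !case: ltP => ?; lra. Qed.

Lemma hat_ge0 y : 0 <= hat y.
Proof. by rewrite /hat /ramp /Num.max; do !case: ltP => ?; lra. Qed.

Lemma smoothstep_itv y : 0 <= smoothstep y <= 1.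
Proof.
by rewrite /smoothstep /ramp /Num.max; do !case: ltP => ?; apply/andP; split; nra.
Qed.

(** The transition from 0 to 1 takes place on [c - s/n, c + (1 - s)/n]; the
    shift s keeps it on the prescribed side of c. *)
Definition scaled_step n c s x := smoothstep (n%:R * (x - c) + s).
Definition scaled_hat n c s x := n%:R * hat (n%:R * (x - c) + s).

Lemma scaled_step_is_derive n c s x : is_derive x 1 (scaled_step n c s) (scaled_hat n c s x).
Proof.
rewrite /scaled_step /scaled_hat mulrC.
have H : is_derive x 1 (fun x => n%:R * (x - c) + s) n%:R.
  have := is_deriveD (is_deriveZ n%:R (is_deriveB (is_derive_id x 1) (is_derive_cst c x 1)))
    (is_derive_cst s x 1).
  by rewrite subr0 addr0 [_ *: _]mulr1.
exact: (@is_derive1_comp _ smoothstep (fun x => n%:R * (x - c) + s) x _ _ (smoothstep_is_derive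
  _) H).
Qed.

Lemma scaled_hat_continuous n c s : continuous (scaled_hat n c s).
Proof.
move=> x; apply: cvgM; first exact: cvg_cst.
apply: (@continuous_comp _ _ _ (fun x => n%:R * (x - c) + s) hat); last exact: hat_continuous.
apply: cvgD; last exact: cvg_cst.
apply: cvgM; first exact: cvg_cst.
by apply: cvgB; [exact: cvg_id|exact: cvg_cst].
Qed.

Lemma scaled_hat_ge0 n c s x : 0 <= scaled_hat n c s x.
Proof. by rewrite mulr_ge0 ?hat_ge0. Qed.

Lemma scaled_step_continuous n c s : continuous (scaled_step n c s).
Proof.
move=> x; apply: differentiable_continuous; apply/derivable1_diffP.
by have [] := scaled_step_is_derive n c s x.
Qed.

Lemma continuous_within_segment v : continuous v -> {within `[0, 1], continuous v}.
Proof. exact: continuous_subspaceT. Qed.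

Lemma Rintegral_D01_itv v : {within `[0, 1], continuous v} ->
  \int[mu]_(x in D) v x = \int[mu]_(x in `[0, 1]) v x.
Proof.
move=> cv; have iv : mu.-integrable `[0, 1] (EFin \o v).
  by apply: continuous_compact_integrable => //; exact: segment_compact.
rewrite /D01 Rintegral_itv_bndo_bndc; last first.
  by apply: integrableS iv => //; exact: subset_itv_oo_cc.
rewrite Rintegral_itv_obnd_cbnd//.
by apply: integrableS iv => //; exact: subset_itv_oc_cc.
Qed.

Lemma scaled_hat_Rintegral n c s : n%:R * (0 - c) + s <= 0 -> 1 <= n%:R * (1 - c) + s ->
  \int[mu]_(x in D) scaled_hat n c s x = 1.
Proof.
move=> h0 h1; rewrite Rintegral_D01_itv; last exact: continuous_within_segment
  (@scaled_hat_continuous _ _ _).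
rewrite /Rintegral (@continuous_FTC2 _ _ (scaled_step n c s))//=.
- by rewrite /scaled_step smoothstep_ge1// smoothstep_le0// subr0.
- exact: continuous_within_segment (@scaled_hat_continuous _ _ _).
- split.
  + by move=> x _; have [] := scaled_step_is_derive n c s x.
  + by apply: cvg_at_right_filter; exact: scaled_step_continuous.
  + by apply: cvg_at_left_filter; exact: scaled_step_continuous.
- by move=> x _; rewrite derive1E; have [] := scaled_step_is_derive n c s x.
Qed.

(** The functions scaled_hat n c s have mass one and concentrate at c, so they
    form an approximate identity there. The last hypothesis puts their supports
    inside [0, 1]; it allows c to be an endpoint. *)
Lemma ip_scaled_hat_cvg v c s : {within `[0, 1], continuous v} -> c \in `[0, 1] ->
  (\forall n \near \oo, n%:R * (0 - c) + s <= 0 /\ 1 <= n%:R * (1 - c) + s) ->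
  ip v (scaled_hat n c s) @[n --> \oo] --> v c.
Proof.
move=> cv c01 Hn; apply/cvgrPdist_le => e e0.
have /subspace_continuousP/(_ _ c01)/cvgrPdist_le/(_ e e0) := cv.
rewrite near_withinE => -[d /= d0 Hd].
near=> n.
have [h0 h1] : n%:R * (0 - c) + s <= 0 /\ 1 <= n%:R * (1 - c) + s by near: n.
have n0 : (0 < n%:R :> R) by rewrite ltr0n; near: n; exact: nbhs_infty_gt.
have nd : (`|s| + 1) / d < n%:R.
  by near: n; exact: nbhs_infty_gtr.
have Lv := L2_continuous cv.
have Lb : L2 (scaled_hat n c s) by apply: L2_continuous; exact: continuous_within_segment
  (@scaled_hat_continuous _ _ _).
have Lc : L2 (fun=> v c) by apply: L2_continuous => x; exact: cvg_cst.
have ib : mu.-integrable D (EFin \o scaled_hat n c s).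
  rewrite (_ : scaled_hat n c s = (fun x => 1 * scaled_hat n c s x));
    last by apply/funext => x; rewrite mul1r.
  by apply: (@L2_integrableM _ (fun=> 1)) => //; apply: L2_continuous => x; exact: cvg_cst.
have -> : v c = ip (fun=> v c) (scaled_hat n c s).
  have := @RintegralZl _ _ _ mu D (scaled_hat n c s) (v c) measurable_D01 ib.
  by rewrite scaled_hat_Rintegral// mulr1 => e1; exact: esym e1.
rewrite -ipBl//; apply: le_trans (@le_normr_Rintegral _ _ _ mu D _ measurable_D01 _) _.
  by apply: L2_integrableM => //; exact: L2B.
rewrite -[leRHS]mulr1 -(scaled_hat_Rintegral h0 h1) -(@RintegralZl _ _ _ mu D _ _ measurable_D01)//.
apply: (@le_Rintegral _ _ _ mu D _ _ measurable_D01).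
- by apply: (@integrable_norm _ _ _ mu D _ _); apply: L2_integrableM => //; exact: L2B.
- exact: integrable_scaleR.
move=> x Dx; rewrite normrM (ger0_norm (scaled_hat_ge0 _ _ _ _)).
have [->|bx] := eqVneq (scaled_hat n c s x) 0; first by rewrite !mulr0.
apply: ler_wpM2r; first exact: scaled_hat_ge0.
apply: Hd => /=; last exact: D01_cc.
have [/andP[y0 y1]|ny] := boolP (0 < n%:R * (x - c) + s < 1); last first.
  by exfalso; move/eqP: bx; apply; rewrite /scaled_hat hat_out ?mulr0//; move: ny;
    rewrite negb_and -!leNgt => /orP.
move: nd; rewrite ltr_pdivrMr// => nd.
rewrite -(@ltr_pM2l _ n%:R)//; apply: le_lt_trans nd.
rewrite -[X in X * _]ger0_norm ?ltW// -normrM.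
have := ler_norm s; have := ler_norm (- s); rewrite normrN => s1 s2.
by rewrite ltr_norml; apply/andP; split; lra.
Unshelve. all: by end_near. Qed.

(** With the shifts -1 and 2 the transitions lie in [a + 1/n, a + 2/n] and
    [b - 2/n, b - 1/n]. The support is thus compact in (0, 1) even for a = 0
    and b = 1, and the limit as n tends to infinity is the indicator of ]a, b[. *)
Definition cutoff a b n := scaled_step n a (-1) \- scaled_step n b 2.

Lemma cutoff_is_derive a b n x :
  is_derive x 1 (cutoff a b n) (scaled_hat n a (-1) x - scaled_hat n b 2 x).
Proof. by have := is_deriveB (scaled_step_is_derive n a (-1) x) (scaled_step_is_derive n b 2
  x). Qed.

Lemma cutoff_derive1 a b n : derive1 (cutoff a b n) = scaled_hat n a (-1) \- scaled_hat n b 2.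
Proof. by apply/funext => x; rewrite derive1E; have [] := cutoff_is_derive a b n x. Qed.

Lemma cutoff_test a b n : 0 <= a -> b <= 1 -> 3 <= n%:R * (b - a) ->
  test_function (cutoff a b n).
Proof.
move=> a0 b1 h.
have n0 : (0 < n%:R :> R).
  by rewrite lt_neqAle ler0n andbT eq_sym; apply/eqP => nE; move: h; rewrite nE; lra.
split.
- by move=> x; have [] := cutoff_is_derive a b n x.
- by rewrite cutoff_derive1 => x; apply: cvgB; exact: scaled_hat_continuous.
- exists (a + n%:R^-1), (b - n%:R^-1).
  have nV : n%:R * n%:R^-1 = 1 :> R by rewrite mulfV// gt_eqF.
  have V0 : 0 < n%:R^-1 :> R by rewrite invr_gt0.
  split; [lra|lra|] => x.
  rewrite in_itv/= negb_and -!ltNge => /orP[] hx; rewrite /cutoff /scaled_step /=.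
  + by rewrite !smoothstep_le0 ?subrr//; nra.
  + by rewrite !smoothstep_ge1 ?subrr//; nra.
Qed.

Lemma cutoff_cvg a b x : a < b -> cutoff a b n x @[n --> \oo] --> (\1_(`]a, b[%classic) x : R).
Proof.
move=> ab; apply: cvg_near_cst.
have big (d : R) : 0 < d -> \forall n \near \oo, 2 <= n%:R * d.
  move=> d0; near=> n.
  by rewrite -ler_pdivrMr//; near: n; exact: nbhs_infty_ger.
have [xa|ax] := leP x a.
  have : 0 < b - x by lra.
  move=> /big; apply: filterS => n hn.
  rewrite indicE mem_setE in_itv/= ltNge xa /= /cutoff /scaled_step /= !smoothstep_le0 ?subrr//.
    by lra.
  have := ler0n R n; nra.
have [xb|bx] := ltP x b.
  have db : 0 < b - x by lra.
  have da : 0 < x - a by lra.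
  near=> n.
  have hb : 2 <= n%:R * (b - x) by near: n; exact: big.
  have ha : 2 <= n%:R * (x - a) by near: n; exact: big.
  rewrite indicE mem_setE in_itv/= ax xb /= /cutoff /scaled_step /=.
  by rewrite smoothstep_ge1 ?smoothstep_le0 ?subr0//; lra.
have : 0 < x - a by lra.
move=> /big; apply: filterS => n hn.
rewrite indicE mem_setE in_itv/= [x < b]ltNge bx andbF /= /cutoff /scaled_step /=.
rewrite !smoothstep_ge1 ?subrr//; last by lra.
have := ler0n R n; nra.
Unshelve. all: by end_near. Qed.

Lemma cutoff_continuous a b n : continuous (cutoff a b n).
Proof. by move=> x; apply: cvgB; exact: scaled_step_continuous. Qed.

Lemma ip_cutoff_cvg g a b : L2 g -> a < b ->
  ip g (cutoff a b n) @[n --> \oo] --> ip g (\1_(`]a, b[%classic)).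
Proof.
move=> Lg ab.
have ig : mu.-integrable D (EFin \o g).
  rewrite (_ : g = (fun x => g x * 1)); last by apply/funext => x; rewrite mulr1.
  by apply: (@L2_integrableM _ _ (fun=> 1)) => //; apply: L2_continuous => x; exact: cvg_cst.
have ing : mu.-integrable D (EFin \o (fun x => `|g x|)).
  exact: (@integrable_norm _ _ _ mu D _ ig).
have Lcut n : L2 (cutoff a b n).
  by apply: L2_continuous; apply: continuous_within_segment; exact: cutoff_continuous.
have [mg _] := Lg.
have [] := @dominated_convergence _ _ _ mu D measurable_D01
  (fun n x => (g x * cutoff a b n x)%:E) (fun x => (g x * \1_(`]a, b[%classic) x)%:E)
  (EFin \o (fun x => `|g x|)).
- by move=> n; apply/measurable_EFinP; apply: measurable_funM => //; have [] := Lcut n.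
- apply/measurable_EFinP; exact: measurable_funM.
- apply: aeW => x _; apply: cvg_EFin; first exact: nearW.
  by apply: cvgM; [exact: cvg_cst|exact: cutoff_cvg].
- exact: ing.
- apply: aeW => x n _; rewrite /= lee_fin normrM -[leRHS]mulr1 ler_wpM2l//.
  have := smoothstep_itv (n%:R * (x - a) + -1); have := smoothstep_itv (n%:R * (x - b) + 2).
  by rewrite /cutoff /scaled_step /= ler_norml => /andP[? ?] /andP[? ?]; apply/andP; split; lra.
move=> i1 _ h; apply: fine_cvg.
have -> : (ip g (\1_(`]a, b[%classic)))%:E = (\int[mu]_(x in D) (g x * \1_(`]a, b[%classic)
  x)%:E)%E.
  by rewrite /ip /Rintegral fineK//; exact: (@integrable_fin_num _ _ _ mu D measurable_D01 _ i1).
exact: h.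
Qed.

End Cutoffs.

(** * Weak derivatives *)

Section WeakDerivatives.
Variable R : realType.
Local Notation mu := (@lebesgue_measure R).
Local Notation D := (@D01 R).
Implicit Types (v w g phi : R -> R) (x y a b c : R).

Lemma test_L2 phi : test_function phi -> L2 phi.
Proof.
move=> [dphi _ _]; apply: L2_continuous; apply: continuous_within_segment => x.
by apply: differentiable_continuous; apply/derivable1_diffP.
Qed.

Lemma test_derive1_L2 phi : test_function phi -> L2 (derive1 phi).
Proof. by move=> [_ cphi _]; apply: L2_continuous; exact: continuous_within_segment. Qed.

(** Test the weak derivative with the cutoffs of ]a, b[: their derivatives tend
    to a Dirac mass at a minus one at b, they themselves tend to the indicator
    of ]a, b[. *)
Lemma weak_deriv_ftc v g a b : {within `[0, 1], continuous v} -> is_weak_deriv v g ->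
  0 <= a -> a < b -> b <= 1 -> v b - v a = ip g (\1_(`]a, b[%classic)).
Proof.
move=> cv [Lg vg] a0 ab b1.
have big : \forall n \near \oo, 3 <= n%:R * (b - a).
  near=> n; rewrite -ler_pdivrMr ?subr_gt0//; near: n; exact: nbhs_infty_ger.
have Lv := L2_continuous cv.
have Lb n (c s : R) : L2 (scaled_hat n c s).
  by apply: L2_continuous; apply: continuous_within_segment; exact: scaled_hat_continuous.
have h1 : ip v (scaled_hat n a (-1)) - ip v (scaled_hat n b 2) @[n --> \oo] --> v a - v b.
  apply: cvgB; apply: ip_scaled_hat_cvg => //; rewrite ?in_itv/=; try by apply/andP; split; lra.
  - apply: filterS big => n hn; have := ler0n R n; split; nra.
  - apply: filterS big => n hn; have := ler0n R n; split; nra.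
have h2 := ip_cutoff_cvg Lg ab.
have h3 : ip v (scaled_hat n a (-1)) - ip v (scaled_hat n b 2) @[n --> \oo] --> - ip g
  (\1_(`]a, b[%classic)).
  apply: cvg_trans (cvgN h2); apply: near_eq_cvg.
  apply: filterS big => n hn; rewrite -ipBr//.
  rewrite /GRing.opp/= -vg; last exact: cutoff_test.
  by rewrite cutoff_derive1.
have := cvg_unique _ h1 h3 => /(_ (@Rhausdorff R)) e.
by rewrite -[RHS]opprK -e opprB.
Unshelve. all: by end_near. Qed.

Lemma ip_indic_itv g x : D x -> ip g (\1_(`]0, x[%classic)) = \int[mu]_(y in `]0, x[) g y.
Proof.
rewrite /D01 /= in_itv/= => /andP[x0 x1].
rewrite -[in RHS](_ : D `&` `]0, x[%classic = `]0, x[%classic); last first.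
  apply: setIidr => y; rewrite /D01 /= !in_itv/= => /andP[-> yx].
  by rewrite (lt_trans yx x1).
rewrite Rintegral_mkcondr; apply: eq_Rintegral => y _.
by rewrite patchE indicE; case: ifP => _; rewrite ?mulr1 ?mulr0.
Qed.

(** The cutoffs show that the integral of g over ]0, x[ vanishes for every x in
    D. By Lebesgue differentiation of x |-> int_0^x g, so does g almost
    everywhere. *)
Lemma du_bois_reymond g : L2 g ->
  (forall phi, test_function phi -> ip g phi = 0) -> ae_eq mu D g (cst 0).
Proof.
move=> Lg g0.
have int0 x : D x -> \int[mu]_(y in `]0, x[) g y = 0.
  move=> Dx; rewrite -ip_indic_itv//.
  have [/= x0 x1] : 0 < x /\ x < 1 by move: Dx; rewrite /D01 /= in_itv/= => /andP[].
  apply: (cvg_unique (@Rhausdorff R) (ip_cutoff_cvg Lg x0)).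
  apply: cvg_near_cst; near=> n; apply: g0; apply: cutoff_test => //; first exact: ltW.
  by rewrite subr0 -ler_pdivrMr//; near: n; exact: nbhs_infty_ger.
have ig : mu.-integrable D (EFin \o g).
  rewrite (_ : g = (fun x => g x * 1)); last by apply/funext => x; rewrite mulr1.
  by apply: (@L2_integrableM _ _ (fun=> 1)) => //; apply: L2_continuous => x; exact: cvg_cst.
pose k := g \_ D.
have ikT : mu.-integrable setT (EFin \o k).
  rewrite -restrict_EFin; apply/(integrable_restrict _ _ _ _).1 => //; first exact: measurable_D01.
  by rewrite setTI.
have ikS A : measurable A -> mu.-integrable A (EFin \o k).
  by move=> mA; exact: (@integrableS _ _ _ mu setT A).
have lk : locally_integrable [set: R] k by exact: integrable_locally.
have := FTC1 (a := BLeft 0) (fun y => ikS _ (measurable_itv _)) lk.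
apply: filterS; first exact: (ae_filter_ringOfSetsType mu).
move=> x /= Hx Dx.
have [x0 x1] : 0 < x /\ x < 1 by move: Dx; rewrite /D01 /= in_itv/= => /andP[].
have [] := Hx; first by rewrite lte_fin.
move=> _; rewrite /k patchE mem_set// => <-.
rewrite derive1E -[RHS](derive_cst (0 : R) x (1 : R)).
apply: near_eq_derive; rewrite ?oner_eq0//.
have nD : \forall y \near x, D y by apply: open_nbhs_nbhs; split => //; exact: interval_open.
apply: filterS nD => y Dy.
rewrite /cst -[RHS](int0 y Dy).
rewrite -Rintegral_itv_obnd_cbnd; last exact: (ikS _ (measurable_itv _)).
rewrite -Rintegral_itv_bndo_bndc; last exact: (ikS _ (measurable_itv _)).
apply: eq_Rintegral => z; rewrite inE/= in_itv/= => /andP[z0 zy].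
rewrite /k patchE mem_set//; move: Dy; rewrite /D01 /= !in_itv/= z0 => /andP[_].
by move=> /(lt_trans zy) ->.
Unshelve. all: by end_near. Qed.

(** This is what makes the arbitrary choice in wderiv harmless: any weak
    derivative computes the same inner products. *)
Lemma weak_deriv_unique v g1 g2 : is_weak_deriv v g1 -> is_weak_deriv v g2 ->
  ae_eq mu D g1 g2.
Proof.
move=> [L1 h1] [L2g h2].
have : ae_eq mu D (g1 \- g2) (cst 0).
  apply: du_bois_reymond; first exact: L2B.
  move=> phi tphi; rewrite ipBl//; last exact: test_L2.
  by apply/eqP; rewrite subr_eq0 -eqr_opp -h1// h2.
by apply: filterS => x h Dx; apply/eqP; rewrite -subr_eq0; apply/eqP/h.
Qed.

Lemma wderivP v g : is_weak_deriv v g -> is_weak_deriv v (wderiv v).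
Proof. by move=> vg; apply: (@xgetPex _ (fun=> 0) [set g | is_weak_deriv v g]); exists g. Qed.

Lemma wderiv_L2 v : L2 (wderiv v).
Proof.
rewrite /wderiv; case: xgetP => [g _ [Lg _]//|_]; exact: L2_0.
Qed.

Lemma wderiv_ae v g : is_weak_deriv v g -> ae_eq mu D (wderiv v) g.
Proof. by move=> vg; apply: (weak_deriv_unique (wderivP vg) vg). Qed.

Lemma ae_eq_weak_deriv v w g : L2 v -> L2 w -> ae_eq mu D v w ->
  is_weak_deriv v g -> is_weak_deriv w g.
Proof.
move=> Lv Lw vw [Lg vg]; split => // phi tphi; rewrite -vg//.
by apply: ae_eq_ip => //; [exact: test_derive1_L2..|exact: ae_eq_sym|exact: ae_eq_refl].
Qed.

Lemma eq_weak_deriv v w g : {in D, v =1 w} -> is_weak_deriv v g -> is_weak_deriv w g.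
Proof. by move=> vw [Lg vg]; split => // phi tphi; rewrite -vg//; apply: eq_ip => // x Dx;
  rewrite vw. Qed.

Lemma eq_wderiv v w : {in D, v =1 w} -> wderiv v = wderiv w.
Proof.
move=> vw; rewrite /wderiv; congr (xget _ _); apply/seteqP; split => g /=.
  exact: eq_weak_deriv.
by apply: eq_weak_deriv => x Dx; rewrite vw.
Qed.

Lemma weak_deriv_lin c v w g k : L2 v -> L2 w -> is_weak_deriv v g -> is_weak_deriv w k ->
  is_weak_deriv (fun x => c * v x + w x) (fun x => c * g x + k x).
Proof.
move=> Lv Lw [Lg vg] [Lk wk]; split; first exact: L2_lin.
move=> phi tphi; have Lphi := test_L2 tphi; have Lp := test_derive1_L2 tphi.
by rewrite !ip_linl// vg// wk//; ring.
Qed.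

(** A C^1 function on [0, 1] together with its derivative; continuity of d on
    the closed interval determines its endpoint values. *)
Definition C1_deriv v (d : R -> R) :=
  [/\ {within `[0, 1], continuous v}, {within `[0, 1], continuous d} &
  forall x, D x -> is_derive x 1 v (d x)].

Lemma C1_deriv_LR v d : C1_deriv v d -> derivable_oo_LRcontinuous v 0 1.
Proof.
move=> [/(continuous_within_itvP _ (@ltr01 R))[_ c0 c1] cd vd]; split => //.
by move=> x x01; have [] := vd x x01.
Qed.

Lemma C1_deriv_weak v d : C1_deriv v d -> is_weak_deriv v d.
Proof.
move=> Hv; have [cv cd vd] := Hv; split; first exact: L2_continuous.
move=> phi tphi; have [dphi cphi [a [b [a0 b1 supp]]]] := tphi.
have cp : continuous phi.
  by move=> x; apply: differentiable_continuous; apply/derivable1_diffP.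
have cvp : {within `[0, 1], continuous (fun x => v x * derive1 phi x)}.
  by move=> x; apply: cvgM; [exact: cv|exact: continuous_within_segment].
have cdp : {within `[0, 1], continuous (fun x => d x * phi x)}.
  by move=> x; apply: cvgM; [exact: cd|exact: continuous_within_segment].
rewrite /ip (Rintegral_D01_itv cvp) (Rintegral_D01_itv cdp).
have phi0 : phi 0 = 0 by apply: supp; rewrite in_itv/= negb_and -!ltNge a0.
have phi1 : phi 1 = 0 by apply: supp; rewrite in_itv/= negb_and -!ltNge b1 orbT.
rewrite (@Rintegration_by_parts _ v phi d (derive1 phi) 0 1 ltr01).
- by rewrite phi0 phi1 !mulr0 subrr sub0r.
- exact: cd.
- exact: C1_deriv_LR Hv.
- by move=> x x01; rewrite derive1E; have [] := vd x x01.
- exact: continuous_within_segment.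
- split; first by move=> x _; exact: dphi.
  + by apply: cvg_at_right_filter; exact: cp.
  + by apply: cvg_at_left_filter; exact: cp.
- by [].
Qed.

(** A test function vanishes near 0 and 1, so that the behaviour of w outside D
    does not matter for the product. *)
Lemma test_mul w d phi : C1_deriv w d -> test_function phi ->
  test_function (fun x => w x * phi x) /\
  derive1 (fun x => w x * phi x) = (fun x => w x * derive1 phi x + d x * phi x).
Proof.
move=> [cw cd wd] [dphi cphi [a [b [a0 b1 supp]]]].
have cp : continuous phi.
  by move=> x; apply: differentiable_continuous; apply/derivable1_diffP.
have out x : x \notin `[a, b] -> \forall y \near x, y \notin `[a, b].
  have : open (~` [set` `[a, b]]) by apply: closed_openC; exact: interval_closed.
  rewrite openE => /(_ x) /= H /negP/H; rewrite /interior.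
  by apply: filterS => y /= /negP.
have inD x : x \in `[a, b] -> D x.
  by rewrite /D01 /= !in_itv/= => /andP[xa xb]; apply/andP; split; lra.
have phi'0 x : x \notin `[a, b] -> derive1 phi x = 0.
  move=> /out nx; rewrite derive1E -(derive_cst (0 : R) (1 : R) x).
  by apply: near_eq_derive; rewrite ?oner_eq0//; apply: filterS nx => y /supp.
have H x : is_derive x 1 (fun x => w x * phi x) (w x * derive1 phi x + d x * phi x).
  have [xab|xab] := boolP (x \in `[a, b]).
    have H1 := wd _ (inD _ xab).
    have H2 : is_derive x 1 phi (derive1 phi x) by rewrite derive1E; apply: DeriveDef.
    have := is_deriveM H1 H2; rewrite (_ : w x * derive1 phi x + _ = w x *: derive1 phi x + phi
      x *: d x); first exact.
    by rewrite /GRing.scale/= [d x * _]mulrC.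
  rewrite supp// phi'0// !mulr0 addr0.
  apply: (@near_eq_is_derive _ _ _ (cst 0)); rewrite ?oner_eq0//.
    by apply: filterS (out _ xab) => y /supp yy; rewrite /cst yy mulr0.
have E : derive1 (fun x => w x * phi x) = (fun x => w x * derive1 phi x + d x * phi x).
  by apply/funext => x; rewrite derive1E; have [] := H x.
split; last exact: E.
split.
- by move=> x; have [] := H x.
- rewrite E => x; have [xab|xab] := boolP (x \in `[a, b]).
    have Dx := inD _ xab.
    have cwx : {for x, continuous w}.
      by move/(continuous_within_itvP _ (@ltr01 R)): cw => [cw _ _]; exact: cw.
    have cdx : {for x, continuous d}.
      by move/(continuous_within_itvP _ (@ltr01 R)): cd => [cd _ _]; exact: cd.
    by apply: cvgD; apply: cvgM; [exact: cwx|exact: cphi|exact: cdx|exact: cp].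
  apply: (@cvg_trans _ (cst (0 : R) @ nbhs x)); last first.
    by rewrite supp// phi'0// !mulr0 addr0; exact: cvg_cst.
  apply: near_eq_cvg; apply: filterS (out _ xab) => y yab.
  by rewrite /cst supp// phi'0// !mulr0 addr0.
- exists a, b; split => // x /supp ->; exact: mulr0.
Qed.

Lemma continuous_bounded v : {within `[0, 1], continuous v} ->
  exists2 c, 0 <= c & forall x, `[0, 1]%classic x -> `|v x| <= c.
Proof.
move=> cv.
have [|c] := EVT_max (f := fun x => `|v x|) (@ler01 R).
  by move=> x; apply: cvg_norm; exact: cv.
by move=> _ H; exists `|v c| => // x x01; exact: H.
Qed.

(** The C^1 factor is moved onto the test function. *)
Lemma weak_deriv_mul v g w d : L2 v -> is_weak_deriv v g -> C1_deriv w d ->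
  is_weak_deriv (fun x => w x * v x) (fun x => w x * g x + d x * v x).
Proof.
move=> Lv [Lg vg] Hw; have [cw cd _] := Hw.
have Lw v' : L2 v' -> L2 (fun x => w x * v' x).
  move=> Lv'; have [c _ wc] := continuous_bounded cw.
  by apply: (L2_mul_bounded (c := c)) => //; [have [] := L2_continuous cw|move=> x Dx;
    apply: wc; exact: D01_cc].
have Ld v' : L2 v' -> L2 (fun x => d x * v' x).
  move=> Lv'; have [c _ wc] := continuous_bounded cd.
  by apply: (L2_mul_bounded (c := c)) => //; [have [] := L2_continuous cd|move=> x Dx;
    apply: wc; exact: D01_cc].
split; first by apply: L2D; [exact: Lw|exact: Ld].
move=> phi tphi; have [twphi E] := test_mul Hw tphi.
have Lphi := test_L2 tphi; have Lp := test_derive1_L2 tphi.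
rewrite (_ : (fun x => w x * g x + _) = (fun x => w x * g x) \+ (fun x => d x * v x))//.
rewrite ipDl//; [|exact: Lw|exact: Ld].
have e1 : ip (fun x => w x * g x) phi = ip g (fun x => w x * phi x).
  by apply: eq_Rintegral => x _; rewrite mulrA [w x * _]mulrC.
have e2 : ip (fun x => d x * v x) phi = ip v (fun x => d x * phi x).
  by apply: eq_Rintegral => x _; rewrite mulrA [d x * _]mulrC.
have e3 : ip (fun x => w x * v x) (derive1 phi) = ip v (fun x => w x * derive1 phi x).
  by apply: eq_Rintegral => x _; rewrite mulrA [w x * _]mulrC.
rewrite e1 e2 e3.
have := vg _ twphi; rewrite E (_ : (fun x => w x * _ + _) = (fun x => w x * derive1 phi x) \+
  (fun x => d x * phi x))//.
rewrite ipDr//; [lra|exact: Lw|exact: Ld].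
Qed.

Lemma ip_indic01 g : ip g (\1_(`]0, 1[%classic)) = ip g (fun=> 1).
Proof.
by apply: eq_Rintegral => x Dx; rewrite indicE (_ : _ \in _)//.
Qed.

(** Apply the fundamental theorem to the product of v and w, whose boundary
    values survive. *)
Lemma weak_ibp v g w d : {within `[0, 1], continuous v} -> is_weak_deriv v g -> C1_deriv w d ->
  ip v d = v 1 * w 1 - v 0 * w 0 - ip g w.
Proof.
move=> cv vg Hw; have Lv := L2_continuous cv; have [cw cd _] := Hw; have [Lg _] := vg.
have cwv : {within `[0, 1], continuous (fun x => w x * v x)}.
  by move=> x; apply: cvgM; [exact: cw|exact: cv].
have := weak_deriv_ftc cwv (weak_deriv_mul Lv vg Hw) (lexx 0) ltr01 (lexx 1).
rewrite ip_indic01 => H.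
have -> : ip v d = v 1 * w 1 - v 0 * w 0 - (v 1 * w 1 - v 0 * w 0 - ip v d) by ring.
congr (_ - _); rewrite [v 1 * _]mulrC [v 0 * _]mulrC H.
rewrite -[LHS]addrC -[RHS]addr0; apply/eqP; rewrite addrC subr_eq addr0; apply/eqP.
rewrite [ip v d]ipC.
have L1 : L2 (fun=> 1 : R) by apply: L2_continuous => x; exact: cvg_cst.
rewrite /ip -(@RintegralD _ _ _ mu D _ _ measurable_D01); last 2 first.
- by apply: L2_integrableM => //; exact: L2_continuous.
- by apply: L2_integrableM => //; exact: L2_continuous.
by apply: eq_Rintegral => x _; rewrite mulr1 [w x * g x]mulrC.
Qed.

End WeakDerivatives.

(** * Classical derivatives and Sobolev norms *)

Lemma L2_measurable (R : realType) (v : R -> R) : L2 v -> measurable_fun (@D01 R) v.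
Proof. by case. Qed.

Opaque ip wderiv L2norm L2 is_weak_deriv.

Section ClassicalSobolev.
Variable R : realType.
Local Notation mu := (@lebesgue_measure R).
Local Notation D := (@D01 R).
Implicit Types (v w g : R -> R) (x y c : R).

Lemma antiderivative v : {within `[0, 1], continuous v} ->
  exists2 F, C1_deriv F v & F 0 = 0.
Proof.
move=> cv; have iv : mu.-integrable `[0, 1] (EFin \o v).
  by apply: continuous_compact_integrable => //; exact: segment_compact.
exists (fun x => parameterized_integral mu 0 x v).
  have cF := parameterized_integral_continuous ler01 iv.
  split.
  - exact: cF.
  - exact: cv.
  move=> x; rewrite /D01 /= => x01; have := x01; rewrite in_itv/= => /andP[x0 x1].
  have cvx : {for x, continuous v}.
    by move/(continuous_within_itvP _ (@ltr01 R)): cv => [cv _ _]; exact: cv.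
  have [dF eF] := continuous_FTC1_closed x1 iv x0 cvx.
  by apply: DeriveDef; [exact: dF|rewrite -derive1E; exact: eF].
by rewrite /parameterized_integral set_itv1 Rintegral_set1.
Qed.

(** wderiv selects some weak derivative, which agrees with the classical one
    almost everywhere only; this suffices for the next differentiation. *)
Lemma classical_wderivn (d : nat -> R -> R) s :
  (forall j, (j <= s)%N -> {within `[0, 1], continuous (d j)}) ->
  (forall j, (j < s)%N -> C1_deriv (d j) (d j.+1)) ->
  forall l, (l <= s)%N -> L2 (wderivn l (d 0%N)) /\ ae_eq mu D (wderivn l (d 0%N)) (d l).
Proof.
move=> cd dd; elim=> [|l IH] ls; first by split; [exact: L2_continuous (cd _ _)|exact: ae_eq_refl].
have [Ll el] := IH (ltnW ls); split; first exact: wderiv_L2.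
apply: wderiv_ae; apply: ae_eq_weak_deriv (C1_deriv_weak (dd _ ls)) => //.
  by have [cl _ _] := dd _ ls; exact: L2_continuous.
exact: ae_eq_sym.
Qed.

Lemma classical_Hs (d : nat -> R -> R) s :
  (forall j, (j <= s)%N -> {within `[0, 1], continuous (d j)}) ->
  (forall j, (j < s)%N -> C1_deriv (d j) (d j.+1)) ->
  Hs s (d 0%N) /\ Hnorm s (d 0%N) = Num.sqrt (\sum_(l < s.+1) L2norm (d l) ^+ 2).
Proof.
move=> cd dd; have H := classical_wderivn cd dd; split.
  split; first exact: L2_continuous (cd _ _).
  move=> l ls; have [Ll el] := H l (ltnW ls).
  have [cl _ _] := dd _ ls.
  by apply: (@wderivP _ _ (d l.+1)); apply: ae_eq_weak_deriv (C1_deriv_weak (dd _ ls));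
    [exact: L2_continuous|exact: Ll|exact: ae_eq_sym].
congr Num.sqrt; apply: eq_bigr => l _; congr (_ ^+ 2).
have [Ll el] := H l (ltn_ord l).
by apply: ae_eq_L2norm => //; apply: L2_continuous; apply: cd; exact: (ltn_ord l).
Qed.

End ClassicalSobolev.

(** * The energy space *)

Section H1.
Variable R : realType.
Local Notation mu := (@lebesgue_measure R).
Local Notation D := (@D01 R).
Implicit Types (v w g : R -> R) (x y c : R).

Lemma C1_deriv_cst c : C1_deriv (fun=> c : R) (fun=> 0).
Proof.
by split => [||x _]; [move=> x; exact: cvg_cst|move=> x; exact: cvg_cst|exact: is_derive_cst].
Qed.

(** By the inequality poincare below, the seminorm of the form B is a norm on
    HH 1 equivalent to that of H^1(D). *)
Definition energy_norm v : R := L2norm (wderiv v).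

Lemma HH1P v : HH 1 v <->
  [/\ {within `[0, 1], continuous v}, v 0 = 0 & is_weak_deriv v (wderiv v)].
Proof.
split=> [[[Lv dv] cv v0]|[cv v0 dv]]; first by split => //; exact: (dv 0%N).
split; [split; [exact: L2_continuous|]|exact: cv|exact: v0].
by move=> l; rewrite ltnS leqn0 => /eqP ->; exact: dv.
Qed.

Lemma HH1_intro v g : {within `[0, 1], continuous v} -> v 0 = 0 -> is_weak_deriv v g -> HH 1 v.
Proof. by move=> cv v0 dv; apply/HH1P; split => //; exact: wderivP dv. Qed.

Lemma HH_HH1 s v : (0 < s)%N -> HH s v -> HH 1 v.
Proof. by move=> s0 [[Lv dv] cv v0]; apply/HH1P; split => //; exact: (dv 0%N). Qed.

Lemma HH1_cont v : HH 1 v -> {within `[0, 1], continuous v}.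
Proof. by case. Qed.

Lemma HH1_L2 v : HH 1 v -> L2 v.
Proof. by move=> [[]]. Qed.

Lemma HH1_weak v : HH 1 v -> is_weak_deriv v (wderiv v).
Proof. by case/HH1P. Qed.

Lemma HH1_0 v : HH 1 v -> v 0 = 0.
Proof. by case. Qed.

Opaque HH Hs.

Lemma HH1_lin c v w : HH 1 v -> HH 1 w -> HH 1 (fun x => c * v x + w x).
Proof.
move=> Hv Hw; have [cv v0 dv] := (HH1P v).1 Hv.
have [cw w0 dw] := (HH1P w).1 Hw.
apply: (@HH1_intro _ (fun x => c * wderiv v x + wderiv w x)).
- by move=> x; apply: cvgD; [apply: cvgM; [exact: cvg_cst|exact: cv]|exact: cw].
- by rewrite v0 w0 mulr0 addr0.
- by apply: weak_deriv_lin; [exact: HH1_L2|exact: HH1_L2|exact: dv|exact: dw].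
Qed.

Lemma HH1_wderiv_lin c v w : HH 1 v -> HH 1 w ->
  ae_eq mu D (wderiv (fun x => c * v x + w x)) (fun x => c * wderiv v x + wderiv w x).
Proof.
move=> Hv Hw; apply: wderiv_ae; apply: weak_deriv_lin; [exact: HH1_L2|exact: HH1_L2
  |exact: HH1_weak|exact: HH1_weak].
Qed.

Lemma HH1_null : HH 1 (fun=> 0 : R).
Proof.
apply: (@HH1_intro _ (fun=> 0)) => //; first by move=> x; exact: cvg_cst.
exact: (C1_deriv_weak (C1_deriv_cst 0)).
Qed.

Lemma HH1Z c v : HH 1 v -> HH 1 (fun x => c * v x).
Proof.
move=> Hv; have := HH1_lin c Hv HH1_null.
by rewrite (_ : (fun x => _ + _) = (fun x => c * v x))//; apply/funext => x; rewrite addr0.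
Qed.

Lemma HH1B v w : HH 1 v -> HH 1 w -> HH 1 (v \- w).
Proof.
move=> Hv Hw; have := HH1_lin (-1) Hw Hv.
by rewrite (_ : (fun x => _ + _) = v \- w)//; apply/funext => x /=; rewrite mulN1r addrC.
Qed.

Lemma HH1D v w : HH 1 v -> HH 1 w -> HH 1 (v \+ w).
Proof.
move=> Hv Hw; have := HH1_lin 1 Hv Hw.
by rewrite (_ : (fun x => _ + _) = v \+ w)//; apply/funext => x /=; rewrite mul1r.
Qed.

Lemma B_sym v w : B v w = B w v.
Proof. exact: ipC. Qed.

Lemma B_lin c v w (z : R -> R) : HH 1 v -> HH 1 w -> B (fun x => c * v x + w x) z = c * B v z +
  B w z.
Proof.
move=> Hv Hw; rewrite /B -ip_linl//; try exact: wderiv_L2.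
apply: ae_eq_ip; try exact: wderiv_L2.
- by apply: L2_lin; exact: wderiv_L2.
- exact: HH1_wderiv_lin.
- exact: ae_eq_refl.
Qed.

Lemma B_eq v v' w w' : {in D, v =1 v'} -> {in D, w =1 w'} -> B v w = B v' w'.
Proof. by move=> e1 e2; rewrite /B (eq_wderiv e1) (eq_wderiv e2). Qed.

Lemma sqr_energy_norm v : energy_norm v ^+ 2 = B v v.
Proof. exact: sqr_L2norm. Qed.

Lemma B_CS v w : `|B v w| <= energy_norm v * energy_norm w.
Proof. by apply: ip_CS; exact: wderiv_L2. Qed.

Opaque B.

Lemma B_Bl v w (z : R -> R) : HH 1 v -> HH 1 w -> B (v \- w) z = B v z - B w z.
Proof.
move=> Hv Hw; rewrite addrC -mulN1r -(B_lin _ _ Hw Hv).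
rewrite (_ : v \- w = fun x => -1 * w x + v x)//.
by apply/funext => x /=; rewrite mulN1r addrC.
Qed.

Lemma B_0l (z : R -> R) : B (fun=> 0) z = 0.
Proof.
have := B_lin 1 z HH1_null HH1_null.
rewrite (_ : (fun=> _) = fun=> 0); last by apply/funext => x; rewrite mul1r addr0.
rewrite mul1r.
by move=> h; apply: (addrI (B (fun=> 0) z)); rewrite addr0 -h.
Qed.

Lemma B_Zl c v (z : R -> R) : HH 1 v -> B (fun x => c * v x) z = c * B v z.
Proof.
move=> Hv; rewrite -[RHS]addr0 -(B_0l z) -(B_lin _ _ Hv HH1_null).
rewrite (_ : (fun x => c * v x) = fun x => c * v x + 0)//.
by apply/funext => x; rewrite addr0.
Qed.

Lemma energy_norm_ge0 v : 0 <= energy_norm v.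
Proof. exact: L2norm_ge0. Qed.

Lemma B_le v w : B v w <= energy_norm v * energy_norm w.
Proof. by apply: le_trans (B_CS _ _); exact: ler_norm. Qed.

Lemma energy_normD v w : HH 1 v -> HH 1 w ->
  energy_norm (v \+ w) <= energy_norm v + energy_norm w.
Proof.
move=> Hv Hw; rewrite /energy_norm; apply: le_trans (L2normD (wderiv_L2 v) (wderiv_L2 w)).
rewrite (@ae_eq_L2norm _ _ (wderiv v \+ wderiv w))//; first exact: wderiv_L2.
  by apply: L2D; exact: wderiv_L2.
have := HH1_wderiv_lin 1 Hv Hw.
rewrite (_ : (fun x => _ + _) = v \+ w); last by apply/funext => x /=; rewrite mul1r.
by apply: filterS => x h Dx; rewrite h// mul1r.
Qed.

Opaque energy_norm.

Lemma energy_normZ c v : HH 1 v -> energy_norm (fun x => c * v x) = `|c| * energy_norm v.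
Proof.
move=> Hv; apply/eqP; rewrite -(@eqrXn2 _ 2) ?mulr_ge0 ?energy_norm_ge0//.
apply/eqP; rewrite exprMn; transitivity (B (fun x => c * v x) (fun x => c * v x)).
  exact: sqr_energy_norm.
transitivity (`|c| ^+ 2 * B v v); last first.
  by congr (_ * _); exact: esym (sqr_energy_norm v).
by rewrite (B_Zl _ _ Hv) B_sym (B_Zl _ _ Hv) real_normK ?num_real// mulrA -expr2.
Qed.

Lemma energy_normB v w : HH 1 v -> HH 1 w ->
  energy_norm (v \- w) <= energy_norm v + energy_norm w.
Proof.
move=> Hv Hw; rewrite -[X in _ <= _ + X]mul1r -[X in _ <= _ + X * _]normr1 -normrN -energy_normZ//.
rewrite (_ : v \- w = v \+ (fun x => -1 * w x)); last by apply/funext => x /=; rewrite mulN1r.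
by apply: energy_normD => //; exact: HH1Z.
Qed.

Lemma L2_cst c : L2 (fun=> c : R).
Proof. by apply: L2_continuous => x; exact: cvg_cst. Qed.

Lemma L2norm_cst1 : L2norm (fun=> 1 : R) <= 1.
Proof. by apply: L2norm_le_bound => //; [exact: L2_cst|move=> x _; rewrite normr1]. Qed.

Lemma C1_deriv_pow m : C1_deriv (fun x : R => x ^+ m.+1) (fun x => m.+1%:R * x ^+ m).
Proof.
split.
- by apply: continuous_subspaceT => x; exact: exprn_continuous.
- apply: continuous_subspaceT => x; apply: cvgM; [exact: cvg_cst|exact: exprn_continuous].
- move=> x _; have := is_deriveX m.+1 (is_derive_id x (1 : R)).
  have -> : (m.+1%:R * x ^+ m.+1.-1)%:A = m.+1%:R * x ^+ m by exact: mulr1.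
  rewrite (_ : id ^+ m.+1 = fun y : R => y ^+ m.+1)//.
  by apply/funext => y; rewrite exprfctE.
Qed.

Lemma HH1_endpoint v : HH 1 v -> v 1 = ip (wderiv v) (fun=> 1).
Proof.
move=> /HH1P[cv v0 dv]; have := weak_ibp cv dv (C1_deriv_cst 1).
by rewrite ipC ip0l v0 mulr1 mul0r subr0 => /eqP; rewrite eq_sym subr_eq0 => /eqP.
Qed.

Lemma HH1_endpoint_le v : HH 1 v -> `|v 1| <= energy_norm v.
Proof.
move=> Hv; rewrite HH1_endpoint//; apply: le_trans (ip_CS (wderiv_L2 v) (L2_cst 1)) _.
by rewrite -[leRHS]mulr1 ler_wpM2l ?L2norm_ge0// L2norm_cst1.
Qed.

Lemma ip_indic_le g x y : L2 g -> 0 <= x -> x < y -> y <= 1 ->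
  `|ip g (\1_(`]x, y[%classic))| <= L2norm g.
Proof.
move=> Lg x0 xy y1.
have bi (z : R) : `|\1_(`]x, y[%classic) z| <= 1 :> R.
  by rewrite indicE; case: (_ \in _) => /=; rewrite ?normr1 ?normr0.
have mi : measurable_fun D (\1_(`]x, y[%classic) : R -> R) by exact: measurable_indic.
have Li : L2 (\1_(`]x, y[%classic) : R -> R).
  have := L2_mul_bounded (L2_cst 1) mi (fun z _ => bi z).
  by rewrite (_ : (fun x => _) = \1_(`]x, y[%classic))//; apply/funext => z; rewrite mulr1.
apply: le_trans (ip_CS Lg Li) _.
by rewrite -[leRHS]mulr1 ler_wpM2l ?L2norm_ge0//; exact: L2norm_le_bound.
Qed.

(** This primitive of -v vanishes at 1 and so removes the boundary term at 1 in
    an integration by parts; the term at 0 is removed by the condition in HH 1. *)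
Lemma backward_primitive v : {within `[0, 1], continuous v} ->
  exists w, [/\ C1_deriv w (fun x => - v x), w 1 = 0 & forall x, x \in `[0, 1] -> `|w x| <=
    L2norm v].
Proof.
move=> cv; have [F HF F0] := antiderivative cv; have [cF _ dF] := HF.
exists (fun x => F 1 - F x); split.
- split.
  + by move=> x; apply: cvgB; [exact: cvg_cst|exact: cF].
  + by move=> x; apply: cvgN; exact: cv.
  + move=> x Dx; have := is_deriveB (is_derive_cst (F 1) x 1) (dF x Dx).
    by rewrite sub0r.
- exact: subrr.
- move=> x; rewrite in_itv/= => /andP[x0]; rewrite le_eqVlt => /predU1P[->|x1].
    by rewrite subrr normr0 L2norm_ge0.
  rewrite (weak_deriv_ftc cF (C1_deriv_weak HF) x0 x1 (lexx 1)).
  by apply: ip_indic_le => //; exact: L2_continuous.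
Qed.

(** If w' = - v and w 1 = 0, integration by parts gives ip v v = ip v' w, while
    |w| <= L2norm v pointwise. *)
Lemma poincare v : HH 1 v -> L2norm v <= energy_norm v.
Proof.
move=> /HH1P[cv v0 dv]; have [w [Hw w1 wb]] := backward_primitive cv.
have [cw _ _] := Hw; have Lv := L2_continuous cv; have Lw := L2_continuous cw.
have := weak_ibp cv dv Hw; rewrite w1 v0 mulr0 mul0r subrr sub0r => H.
have nw : L2norm w <= L2norm v.
  by apply: L2norm_le_bound; [exact: L2norm_ge0|exact: Lw|move=> x Dx; apply: wb; exact: D01_cc].
have H2 : ip v v = ip (wderiv v) w.
  rewrite -[RHS]opprK -H (_ : (fun x => - v x) = (fun x => -1 * v x)).
    by rewrite ipZr// mulN1r opprK.
  by apply/funext => x; rewrite mulN1r.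
have H3 : L2norm v ^+ 2 <= energy_norm v * L2norm v.
  rewrite sqr_L2norm H2; apply: le_trans (ip_le (wderiv_L2 v) Lw) _.
  by rewrite ler_wpM2l ?L2norm_ge0.
have [->|n0] := eqVneq (L2norm v) 0; first exact: energy_norm_ge0.
by move: H3; rewrite expr2 ler_pM2r// lt_neqAle eq_sym n0 L2norm_ge0.
Qed.

(** Integrate by parts against x^(m+1), which vanishes at 0 and equals 1 at 1. *)
Lemma HH1_endpoint_moment m v : HH 1 v ->
  v 1 = m.+1%:R * ip v (fun x => x ^+ m) + ip (wderiv v) (fun x => x ^+ m.+1).
Proof.
move=> /HH1P[cv v0 dv]; have := weak_ibp cv dv (C1_deriv_pow m).
rewrite expr1n mulr1 v0 mul0r subr0 ipZr; first by move=> ->; rewrite subrK.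
  by apply: L2_continuous; apply: continuous_subspaceT => x; exact: exprn_continuous.
exact: L2_continuous.
Qed.

Lemma Hnorm1E v : Hnorm 1 v = Num.sqrt (L2norm v ^+ 2 + energy_norm v ^+ 2).
Proof. by rewrite /Hnorm !big_ord_recl big_ord0 addr0. Qed.

Lemma energy_le_Hnorm1 v : energy_norm v <= Hnorm 1 v.
Proof.
rewrite Hnorm1E -[leLHS]ger0_norm ?energy_norm_ge0// -sqrtr_sqr ler_sqrt ?lerDr ?sqr_ge0//.
by rewrite addr_ge0 ?sqr_ge0.
Qed.

Lemma Hnorm1_le v : HH 1 v -> Hnorm 1 v <= 2 * energy_norm v.
Proof.
move=> Hv; have n0 := energy_norm_ge0 v; have p := poincare Hv; have l0 := L2norm_ge0 v.
rewrite Hnorm1E -[leRHS]ger0_norm ?mulr_ge0// -sqrtr_sqr ler_sqrt ?sqr_ge0//.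
rewrite exprMn; have : L2norm v ^+ 2 <= energy_norm v ^+ 2 by rewrite lerXn2r ?nnegrE.
by have := sqr_ge0 (energy_norm v); lra.
Qed.

Lemma Hnorm_ge0 s v : 0 <= Hnorm s v.
Proof. exact: sqrtr_ge0. Qed.

End H1.

(** * The elliptic projection *)

Section EllipticProjection.
Variable R : realType.
Local Notation mu := (@lebesgue_measure R).
Local Notation D := (@D01 R).
Implicit Types (V : set (R -> R)) (v w p g chi eta : R -> R) (x y h : R).

Lemma sqr_L2norm_pow m : L2norm (fun x : R => x ^+ m.+1) ^+ 2 = m.*2.+3%:R^-1.
Proof.
have c1 := C1_deriv_pow R m.*2.+2.
have [cst1 _ _] := C1_deriv_cst (1 : R).
have := weak_ibp cst1 (C1_deriv_weak (C1_deriv_cst 1)) c1.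
rewrite ip0l expr1n expr0n/= mulr0 mulr1 !subr0 ipZr; last 2 first.
- by apply: L2_continuous; apply: continuous_subspaceT => x; exact: exprn_continuous.
- exact: L2_cst.
move=> e; rewrite sqr_L2norm.
have n0 : m.*2.+3%:R != 0 :> R by rewrite pnatr_eq0.
apply: (mulfI n0); rewrite mulfV// -[RHS]e; congr (_ * _).
by apply: eq_Rintegral => x _; rewrite mul1r -exprD addSn addnS addnn.
Qed.

(** In HH1_endpoint_moment the derivative of v is paired with x^(m+1), whose
    squared L2 norm 1/(2m+3) is as small as desired. This lets the energy
    absorb the boundary term with coefficient delta. *)
Lemma trace_interpolation e : 0 < e ->
  exists2 K : R, 0 <= K & forall v, HH 1 v ->
    v 1 ^+ 2 <= e * energy_norm v ^+ 2 + K * L2norm v ^+ 2.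
Proof.
move=> e0; pose m := Num.truncn (2 / e).
have me : 2 / m.*2.+3%:R <= e.
  have : 2 / e < m.+1%:R by apply: truncnS_gt.
  rewrite ltr_pdivrMr// => h; rewrite ler_pdivrMr ?ltr0n//.
  apply: le_trans (ltW h) _; rewrite mulrC ler_pM2l// ler_nat.
  by rewrite ltnS -addnn; apply: (leq_trans (leq_addr m m)); rewrite -addn2 leq_addr.
exists (2 * m.+1%:R ^+ 2); first by rewrite mulr_ge0 ?sqr_ge0.
move=> v Hv; have Lv := HH1_L2 Hv.
have Lpow k : L2 (fun x : R => x ^+ k).
  by apply: L2_continuous; apply: continuous_subspaceT => x; exact: exprn_continuous.
have b1 := ip_CS Lv (Lpow m).
have b2 := ip_CS (wderiv_L2 v) (Lpow m.+1).
have p1 : L2norm (fun x : R => x ^+ m) <= 1.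
  apply: L2norm_le_bound; [exact: ler01|exact: Lpow|].
  move=> x; rewrite /D01 /= in_itv/= => /andP[x0 x1].
  by rewrite normrX exprn_ile1 ?normr_ge0// ger0_norm ltW.
rewrite (HH1_endpoint_moment m Hv).
have p2 := sqr_L2norm_pow m.
set A := ip v _; set Bb := ip (wderiv v) _.
have A2 : A ^+ 2 <= L2norm v ^+ 2.
  apply: ler_sqr_norm; apply: le_trans b1 _.
  by rewrite -[leRHS]mulr1 ler_wpM2l ?L2norm_ge0.
have B2 : Bb ^+ 2 <= energy_norm v ^+ 2 * m.*2.+3%:R^-1.
  by rewrite -p2 -exprMn; apply: ler_sqr_norm.
apply: (@le_trans _ _ (2 * (m.+1%:R ^+ 2 * A ^+ 2) + 2 * Bb ^+ 2)).
  by have := sqr_ge0 (m.+1%:R * A - Bb); rewrite sqrrB sqrrD exprMn; lra.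
rewrite addrC; apply: lerD.
  apply: le_trans (ler_wpM2l _ B2) _ => //.
  by rewrite mulrCA mulrC ler_wpM2r ?sqr_ge0.
by rewrite -mulrA ler_wpM2l// ler_wpM2l ?sqr_ge0.
Qed.

(** The indices are listed explicitly to allow induction on the list. *)
Definition lincomb n (b : 'I_n -> R -> R) (s : seq 'I_n) (c : 'I_n -> R) : R -> R :=
  fun x => \sum_(i <- s) c i * b i x.

Lemma lincomb_cons n (b : 'I_n -> R -> R) i s c :
  lincomb b (i :: s) c = fun x => c i * b i x + lincomb b s c x.
Proof. by apply/funext => x; rewrite /lincomb big_cons. Qed.

Lemma lincomb_nil n (b : 'I_n -> R -> R) c : lincomb b [::] c = fun=> 0.
Proof. by apply/funext => x; rewrite /lincomb big_nil. Qed.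

Lemma HH1_lincomb n (b : 'I_n -> R -> R) s c :
  (forall i, HH 1 (b i)) -> HH 1 (lincomb b s c).
Proof.
move=> Hb; elim: s => [|i s IH]; first by rewrite lincomb_nil; exact: HH1_null.
by rewrite lincomb_cons; apply: HH1_lin; [exact: Hb|exact: IH].
Qed.

Lemma B_lincomb n (b : 'I_n -> R -> R) s c w :
  (forall i, HH 1 (b i)) -> B (lincomb b s c) w = \sum_(i <- s) c i * B (b i) w.
Proof.
move=> Hb; elim: s => [|i s IH]; first by rewrite lincomb_nil B_0l big_nil.
by rewrite lincomb_cons (B_lin _ _ (Hb i) (HH1_lincomb s c Hb)) big_cons IH.
Qed.

Lemma energy_norm0_B v w : energy_norm w = 0 -> B v w = 0.
Proof.
move=> w0; apply/eqP; rewrite -normr_le0; apply: le_trans (B_CS v w) _.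
by rewrite w0 mulr0.
Qed.

(** The Galerkin system has the Gram matrix of the generators, which may be
    singular when they are dependent. It is solvable since its right-hand side
    is orthogonal to the kernel: a combination in the kernel has zero energy,
    hence is orthogonal to v. *)
Lemma elliptic_projection_exists V v : finite_dim_subspace V -> V `<=` HH 1 ->
  exists p, is_elliptic_projection V v p.
Proof.
move=> [n [b VE]] VH; pose e := index_enum 'I_n.
have Vlin c : V (lincomb b e c) by rewrite VE; exists c.
have Vb i : V (b i).
  rewrite VE; exists (fun j => (j == i)%:R) => x _.
  rewrite (bigD1 i)//= eqxx mul1r big1 ?addr0// => j /negbTE ->.
  by rewrite mul0r.
have Hb i : HH 1 (b i) := VH _ (Vb i).
pose G : 'M[R]_n := \matrix_(i, j) B (b i) (b j).
pose d : 'rV[R]_n := \row_j B v (b j).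
have dG : (d <= G)%MS.
  rewrite submxE; apply/eqP/matrixP => i j; rewrite ord1 [RHS]mxE {i}.
  (* A column of the cokernel is a vector of coefficients k with G k = 0. *)
  pose k := fun i => cokermx G i j.
  have Gk i : \sum_l G i l * k l = 0.
    by have := mulmx_coker G => /matrixP/(_ i j); rewrite !mxE.
  have Bbw i : B (b i) (lincomb b e k) = 0.
    rewrite B_sym (B_lincomb _ _ _ Hb) -[RHS](Gk i); apply: eq_bigr => l _.
    by rewrite /G mxE mulrC (B_sym (b i)).
  have w0 : energy_norm (lincomb b e k) = 0.
    apply/eqP; rewrite -sqrf_eq0 sqr_energy_norm (B_lincomb _ _ _ Hb); apply/eqP.
    by rewrite big1// => i _; rewrite Bbw mulr0.
  rewrite mxE; have := energy_norm0_B v w0.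
  rewrite B_sym (B_lincomb _ _ _ Hb) => Bk; rewrite -[RHS]Bk; apply: eq_bigr => i _.
  by rewrite /d mxE mulrC B_sym.
have /submxP[c dE] := dG.
exists (lincomb b e (c 0)); split; first exact: Vlin.
move=> phi Vphi; have [k phiE] : exists k : 'I_n -> R, forall x, x \in `[0, 1] -> phi x =
  lincomb b e k x.
  by move: Vphi; rewrite VE => -[k kE]; exists k.
have eD : {in D, phi =1 lincomb b e k} by move=> x; rewrite inE => /D01_cc/phiE.
have er w : {in D, w =1 w} by [].
rewrite (B_eq (er _) eD) (B_eq (er v) eD) B_sym (B_lincomb _ _ _ Hb) (B_sym v) (B_lincomb _ _ _ Hb).
have Bj j : B (lincomb b e (c 0)) (b j) = B v (b j).
  have := congr1 (fun A : 'rV[R]_n => A 0 j) dE; rewrite /d mxE => ->.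
  by rewrite mxE (B_lincomb _ _ _ Hb); apply: eq_bigr => i _; rewrite /G mxE.
by apply: eq_bigr => j _; rewrite (B_sym (b j) (lincomb b e (c 0))) Bj (B_sym v).
Qed.

Lemma finite_dim_lin V c v w : finite_dim_subspace V -> V v -> V w ->
  V (fun x => c * v x + w x).
Proof.
move=> [n [b ->]] [k vE] [l wE]; exists (fun i => c * k i + l i) => x x01.
rewrite vE// wE// mulr_sumr -big_split; apply: eq_bigr => i _.
by rewrite mulrDl mulrA.
Qed.

Lemma finite_dim_B V v w : finite_dim_subspace V -> V v -> V w -> V (v \- w).
Proof.
move=> fV Vv Vw; have := finite_dim_lin (-1) fV Vw Vv.
by rewrite (_ : (fun x => _ + _) = v \- w)//; apply/funext => x /=; rewrite mulN1r addrC.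
Qed.

Lemma wderiv_id : ae_eq mu D (wderiv (@id R)) (fun=> 1).
Proof.
apply: wderiv_ae; have := C1_deriv_weak (C1_deriv_pow R 0).
rewrite (_ : (fun x : R => x ^+ 1) = id); last by apply/funext => x; rewrite expr1.
by rewrite (_ : (fun x : R => 1%:R * x ^+ 0) = fun=> 1)//; apply/funext => x; rewrite mul1r expr0.
Qed.

(** The identity belongs to V, and B w id is the integral of w', that is w 1.
    The projection error therefore vanishes at the dynamical boundary point,
    and no boundary term of it enters the error equation. *)
Lemma elliptic_projection_endpoint V v p : V `<=` HH 1 -> V id -> HH 1 v ->
  is_elliptic_projection V v p -> p 1 = v 1.
Proof.
move=> VH Vid Hv [Vp pE]; have Hp := VH _ Vp.
have E w : HH 1 w -> B w id = w 1.
  move=> Hw; rewrite (HH1_endpoint Hw); apply: ae_eq_ip.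
  - exact: wderiv_L2.
  - exact: wderiv_L2.
  - exact: wderiv_L2.
  - exact: L2_cst.
  - exact: ae_eq_refl.
  - exact: wderiv_id.
by rewrite -E// pE// E.
Qed.

(** The projection error is B-orthogonal to V. *)
Lemma cea V v p chi : finite_dim_subspace V -> V `<=` HH 1 -> HH 1 v ->
  is_elliptic_projection V v p -> V chi ->
  energy_norm (p \- v) <= energy_norm (v \- chi).
Proof.
move=> fV VH Hv [Vp pE] Vchi; have Hp := VH _ Vp; have Hchi := VH _ Vchi.
have He := HH1B Hp Hv.
have orth phi : V phi -> B (p \- v) phi = 0.
  by move=> Vphi; rewrite (B_Bl _ Hp Hv) pE// subrr.
have H : energy_norm (p \- v) ^+ 2 <= energy_norm (p \- v) * energy_norm (v \- chi).
  have o1 : B (p \- chi) (p \- v) = 0 by rewrite B_sym orth//; exact: finite_dim_B.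
  rewrite sqr_energy_norm.
  have -> : B (p \- v) (p \- v) = - B (p \- v) (v \- chi).
    rewrite [in RHS]B_sym (B_Bl _ Hv Hchi) (B_Bl (p \- v) Hp Hv).
    by move: o1; rewrite (B_Bl _ Hp Hchi) => /subr0_eq ->; rewrite opprB.
  by apply: le_trans (B_CS _ _); rewrite -normrN; exact: ler_norm.
have [->|n0] := eqVneq (energy_norm (p \- v)) 0; first exact: energy_norm_ge0.
by move: H; rewrite expr2 ler_pM2l// lt_neqAle eq_sym n0 energy_norm_ge0.
Qed.

Lemma best_approx_ge h V v m : V !=set0 ->
  (forall chi, V chi -> m <= L2norm (v \- chi) + h * Hnorm 1 (v \- chi)) ->
  m <= best_approx h V v.
Proof.
move=> [chi Vchi] H; apply: lb_le_inf; first by exists (L2norm (v \- chi) + h * Hnorm 1 (v \-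
  chi)), chi.
by move=> _ [phi Vphi <-]; exact: H.
Qed.

Lemma cea_best_approx h V v p : 0 < h -> finite_dim_subspace V -> V `<=` HH 1 -> HH 1 v ->
  is_elliptic_projection V v p ->
  h * energy_norm (p \- v) <= best_approx h V v.
Proof.
move=> h0 fV VH Hv Pp; apply: best_approx_ge; first by exists p; case: Pp.
move=> chi Vchi; apply: (@le_trans _ _ (h * energy_norm (v \- chi))).
  by apply: (ler_wpM2l (ltW h0)); exact: (cea fV VH Hv Pp Vchi).
apply: ler_wpDl; first exact: L2norm_ge0.
by apply: (ler_wpM2l (ltW h0)); exact: energy_le_Hnorm1.
Qed.

(** z solves - z'' = eta with z 0 = 0 and z' 1 = 0. As eta vanishes at both
    endpoints, B eta z has no boundary terms. *)
Lemma dual_problem eta : HH 1 eta -> eta 1 = 0 ->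
  exists z, [/\ HH 2 z, B eta z = ip eta eta & Hnorm 2 z <= 2 * L2norm eta].
Proof.
move=> Heta eta1; have ceta := HH1_cont Heta.
have [w [Hw w1 wb]] := backward_primitive ceta.
have [cw _ _] := Hw; have Lw := L2_continuous cw.
have [z Hz z0] := antiderivative cw; have [cz _ _] := Hz.
have cneta : {within `[0, 1], continuous (fun x => - eta x)} by have [] := Hw.
pose d := fun j : nat => match j with 0 => z | 1 => w | _ => fun x => - eta x end.
have [Hs2 nE] : Hs 2 z /\ Hnorm 2 z = Num.sqrt (\sum_(l < 3) L2norm (d l) ^+ 2).
  by apply: (@classical_Hs _ d 2); case=> [|[|[|]]].
have Hz1 : HH 1 z := HH1_intro cz z0 (C1_deriv_weak Hz).
exists z; split.
- by rewrite /HH; split.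
- have -> : B eta z = ip (wderiv eta) w.
    apply: ae_eq_ip.
    + exact: wderiv_L2.
    + exact: wderiv_L2.
    + exact: wderiv_L2.
    + exact: Lw.
    + exact: ae_eq_refl.
    + exact: wderiv_ae (C1_deriv_weak Hz).
  have := weak_ibp ceta (HH1_weak Heta) Hw.
  rewrite w1 (HH1_0 Heta) mulr0 mul0r subrr sub0r (_ : (fun x => - eta x) = (fun x => -1 * eta x)).
    by rewrite ipZr; [rewrite mulN1r => /oppr_inj ->|exact: HH1_L2|exact: HH1_L2].
  by apply/funext => x; rewrite mulN1r.
- have nw : L2norm w <= L2norm eta.
    by apply: L2norm_le_bound; [exact: L2norm_ge0|exact: Lw|move=> x Dx; apply: wb; exact: D01_cc].
  have nz : L2norm z <= L2norm w.
    apply: le_trans (poincare Hz1) _.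
    rewrite le_eqVlt; apply/orP; left; apply/eqP.
    by apply: ae_eq_L2norm; [exact: wderiv_L2|exact: Lw|exact: wderiv_ae (C1_deriv_weak Hz)].
  have ne : L2norm (fun x => - eta x) = L2norm eta.
    rewrite (_ : (fun x => - eta x) = (fun x => -1 * eta x)).
      by rewrite L2normZ; [rewrite normrN1 mul1r|exact: HH1_L2].
    by apply/funext => x; rewrite mulN1r.
  rewrite nE -[leRHS]ger0_norm ?mulr_ge0 ?L2norm_ge0// -sqrtr_sqr ler_sqrt ?sqr_ge0//.
  rewrite !big_ord_recl big_ord0 addr0 /= ne exprMn.
  have l0 := L2norm_ge0 z; have l1 := L2norm_ge0 w; have l2 := L2norm_ge0 eta.
  have : L2norm w ^+ 2 <= L2norm eta ^+ 2 by rewrite lerXn2r ?nnegrE.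
  have : L2norm z ^+ 2 <= L2norm w ^+ 2 by rewrite lerXn2r ?nnegrE.
  by have := sqr_ge0 (L2norm eta); lra.
Qed.

(** By orthogonality ip eta eta = B eta (z - chi) for all chi in V, where z is
    the dual solution; approximating z to first order in energy gains one power
    of h. *)
Lemma aubin_nitsche h V C v p : 0 < h -> 0 <= C -> V `<=` HH 1 -> V id -> HH 1 v ->
  (forall z, HH 2 z -> best_approx h V z <= C * h ^+ 2 * Hnorm 2 z) ->
  is_elliptic_projection V v p ->
  L2norm (p \- v) <= 2 * C * h * energy_norm (p \- v).
Proof.
move=> h0 C0 VH Vid Hv approx Pp; have [Vp pE] := Pp; have Hp := VH _ Vp.
have He := HH1B Hp Hv.
have e1 : (p \- v) 1 = 0 by rewrite /= (elliptic_projection_endpoint VH Vid Hv Pp) subrr.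
have orth phi : V phi -> B (p \- v) phi = 0.
  by move=> Vphi; rewrite (B_Bl _ Hp Hv) pE// subrr.
have [z [Hz2 BE nz]] := dual_problem He e1.
have Hz := HH_HH1 (ltn0Sn 1) Hz2.
set eta := p \- v in He e1 orth BE nz *.
have n0 := energy_norm_ge0 eta; have l0 := L2norm_ge0 eta.
have [nE|nN] := eqVneq (energy_norm eta) 0.
  by have := poincare He; rewrite nE mulr0.
have np : 0 < energy_norm eta by rewrite lt_neqAle eq_sym nN.
have key : h * L2norm eta ^+ 2 / energy_norm eta <= best_approx h V z.
  apply: best_approx_ge; first by exists p.
  move=> chi Vchi; have Hchi := VH _ Vchi.
  rewrite ler_pdivrMr// sqr_L2norm -BE.
  have -> : B eta z = B eta (z \- chi).
    by rewrite [RHS]B_sym (B_Bl _ Hz Hchi) (B_sym chi) (orth chi Vchi) subr0 B_sym.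
  have b := B_le eta (z \- chi); have e := energy_le_Hnorm1 (z \- chi).
  have le0 := L2norm_ge0 (z \- chi).
  apply: le_trans (ler_wpM2l (ltW h0) b) _.
  rewrite mulrCA mulrC; apply: ler_wpM2r => //.
  by apply: ler_wpDl => //; rewrite ler_pM2l.
have [lE|lN] := eqVneq (L2norm eta) 0.
  by rewrite lE !mulr_ge0// ltW.
have lp : 0 < L2norm eta by rewrite lt_neqAle eq_sym lN.
have {key} : h * L2norm eta ^+ 2 / energy_norm eta <= C * h ^+ 2 * (2 * L2norm eta).
  apply: le_trans key _; apply: le_trans (approx z Hz2) _.
  by apply: ler_wpM2l => //; rewrite mulr_ge0 ?sqr_ge0.
rewrite ler_pdivrMr// => H; rewrite -(@ler_pM2l _ (h * L2norm eta)) ?mulr_gt0//.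
have -> : h * L2norm eta * L2norm eta = h * L2norm eta ^+ 2 by rewrite expr2 mulrA.
apply: le_trans H _.
by rewrite le_eqVlt; apply/orP; left; apply/eqP; ring.
Qed.

(** The case s = r of the approximation property bounds the energy of the
    error, the case s = 1 serves for the dual solution; the latter is where
    r > 0 is needed. *)
Lemma projection_error r hstar (S : R -> set (R -> R)) : (0 < r)%N -> fe_family r hstar S ->
  exists2 C, 0 <= C & forall h v p, 0 < h <= hstar -> HH r.+1 v ->
    is_elliptic_projection (S h) v p ->
    L2norm (p \- v) <= C * h ^+ r.+1 * Hnorm r.+1 v /\
    h * energy_norm (p \- v) <= C * h ^+ r.+1 * Hnorm r.+1 v.
Proof.
move=> r0 [Sfe [C0 approx]]; pose C := Num.max 0 C0.
have Cp : 0 <= C by rewrite le_max lexx.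
have C0C : C0 <= C by rewrite le_max lexx orbT.
exists (C + 2 * C * C); first by rewrite addr_ge0 ?mulr_ge0.
move=> h v p hh Hv Pp; have /andP[h0 _] := hh.
have [fV VH _ Vid] := Sfe h hh.
have Hv1 := HH_HH1 (ltn0Sn r) Hv.
have X0 : 0 <= h ^+ r.+1 * Hnorm r.+1 v by rewrite mulr_ge0 ?Hnorm_ge0// exprn_ge0// ltW.
have b1 : h * energy_norm (p \- v) <= C * (h ^+ r.+1 * Hnorm r.+1 v).
  apply: le_trans (cea_best_approx h0 fV VH Hv1 Pp) _.
  apply: le_trans (approx h hh r (leqnn r) v Hv) _.
  by rewrite -mulrA ler_wpM2r.
have b2 : L2norm (p \- v) <= 2 * C * h * energy_norm (p \- v).
  apply: (@aubin_nitsche h (S h)) => //.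
  move=> z Hz; apply: le_trans (approx h hh 1%N r0 z Hz) _.
  apply: ler_wpM2r; first exact: Hnorm_ge0.
  by apply: ler_wpM2r; [exact: sqr_ge0|exact: C0C].
set Y := h ^+ r.+1 * Hnorm r.+1 v in X0 b1.
have CY : 0 <= C * Y by rewrite mulr_ge0.
have CCY : 0 <= 2 * (C * (C * Y)) by apply: mulr_ge0 => //; exact: mulr_ge0.
have -> : (C + 2 * C * C) * h ^+ r.+1 * Hnorm r.+1 v = C * Y + 2 * (C * (C * Y)).
  by rewrite /Y; ring.
split; last by apply: le_trans b1 _; rewrite lerDl.
apply: le_trans b2 _; apply: ler_wpDl => //.
by rewrite -!mulrA; apply: ler_wpM2l => //; apply: ler_wpM2l.
Qed.

End EllipticProjection.

(** * Difference quotients and Gronwall's inequality *)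

Section OneVariableCalculus.
Variable R : realType.
Implicit Types (f : R -> R) (x t T e d a b : R).

Lemma diff_quotP (A : set R) f t d :
  diff_quot f t @ within A t^' --> d <->
  forall e, 0 < e -> exists2 r, 0 < r & forall s, `|t - s| < r -> s != t -> A s ->
    `|d - diff_quot f t s| <= e.
Proof.
split=> [/cvgrPdist_le H e e0|H].
  have [r /= r0 Hr] := H _ e0.
  exists r; first exact: r0.
  by move=> s sr st As; apply: Hr.
apply/cvgrPdist_le => e e0; have [r r0 Hr] := H _ e0.
by exists r => //= s sr st As; exact: Hr.
Qed.

Lemma diff_quot_is_derive f a b x d : x \in `]a, b[ ->
  diff_quot f x @ within `[a, b] x^' --> d -> is_derive x 1 f d.
Proof.
rewrite in_itv/= => /andP[ax xb] /diff_quotP H.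
have lim : h^-1 *: (f (h + x) - f x) @[h --> 0^'] --> d.
  apply/cvgrPdist_le => e e0; have [r r0 Hr] := H _ e0.
  have m0 : 0 < Num.min r (Num.min (x - a) (b - x)) by rewrite !lt_min r0 !subr_gt0 ax xb.
  near=> h.
  have h0 : h != 0 by near: h; exact: nbhs_dnbhs_neq.
  have : `|h| < Num.min r (Num.min (x - a) (b - x)).
    near: h; apply: dnbhs0_lt; exact: m0.
  rewrite !lt_min => /and3P[hr ha hb].
  have hx : h + x != x by rewrite -subr_eq0 addrK.
  have := Hr (h + x); rewrite /diff_quot addrK.
  rewrite (_ : `|x - (h + x)| = `|h|); last by rewrite opprD addrCA subrr addr0 normrN.
  move=> /(_ hr hx); rewrite mulrC; apply; rewrite /= in_itv/=.
  by move: ha hb; rewrite !ltr_norml => /andP[? ?] /andP[? ?]; apply/andP; split; lra.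
apply: DeriveDef.
- by apply/cvg_ex; exists d; under eq_fun do rewrite /= [_%:A]mulr1.
- by apply/cvg_lim => //; under eq_fun do rewrite /= [_%:A]mulr1.
Unshelve. all: by end_near. Qed.

Lemma diff_quot_continuous (A : set R) f t d :
  diff_quot f t @ within A t^' --> d -> f @ within A (nbhs t) --> f t.
Proof.
move=> /diff_quotP H; apply/cvgrPdist_le => e e0.
have [r r0 Hr] := H 1 ltr01.
have c0 : 0 < e / (`|d| + 1) by rewrite divr_gt0// ltr_wpDl.
exists (Num.min r (e / (`|d| + 1))) => /=; first by rewrite lt_min r0 c0.
move=> s /=; rewrite lt_min => /andP[sr sd] As.
have [->|st] := eqVneq s t; first by rewrite subrr normr0 ltW.
have := Hr s sr st As; rewrite /diff_quot => Q.
have st0 : s - t != 0 by rewrite subr_eq0.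
rewrite (_ : f t - f s = (f s - f t) / (s - t) * (t - s)); last first.
  by rewrite -opprB -[t - s]opprB mulrN divfK.
rewrite normrM; set q := _ / _ in Q *.
have qd : `|q| <= `|d| + 1.
  have -> : q = d - (d - q) by rewrite opprB addrC subrK.
  by apply: le_trans (ler_normB _ _) _; rewrite lerD2l.
apply: (@le_trans _ _ ((`|d| + 1) * (e / (`|d| + 1)))); last first.
  by rewrite mulrCA mulfV ?mulr1// gt_eqF// ltr_wpDl.
by apply: ler_pM => //; exact: ltW.
Qed.

Lemma diff_quot_within_continuous a b f (d : R -> R) :
  (forall t, t \in `[a, b] -> diff_quot f t @ within `[a, b] t^' --> d t) ->
  {within `[a, b], continuous f}.
Proof.
move=> H; apply/subspace_continuousP => t tab.
exact: diff_quot_continuous (H t tab).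
Qed.

(** The function exp(- c t) y t - k int_0^t G is nonincreasing. *)
Lemma gronwall T (y y' G : R -> R) (c k : R) : 0 <= c -> 0 <= k ->
  {within `[0, T], continuous y} -> {within `[0, T], continuous G} ->
  (forall t, t \in `[0, T] -> 0 <= G t) -> y 0 <= 0 ->
  (forall t, t \in `]0, T[ -> is_derive t 1 y (y' t) /\ y' t <= c * y t + k * G t) ->
  forall t, t \in `[0, T] ->
    y t <= expR (c * T) * k * \int[@lebesgue_measure R]_(s in `[0, t]) G s.
Proof.
move=> c0 k0 cy cG G0 y0 Hy t tT; have [t0 tT'] : 0 <= t /\ t <= T by move: tT;
  rewrite in_itv/= => /andP[].
have T0 : 0 <= T := le_trans t0 tT'.
pose mu := @lebesgue_measure R.
have iG : mu.-integrable `[0, T] (EFin \o G).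
  by apply: continuous_compact_integrable => //; exact: segment_compact.
pose I x := parameterized_integral mu 0 x G.
have cI : {within `[0, T], continuous I} := parameterized_integral_continuous T0 iG.
pose E x := expR (- c * x).
have dE x : is_derive x 1 E (- c * E x).
  have H : is_derive x 1 (fun x => - c * x) (- c).
    have := is_deriveZ (- c) (is_derive_id x 1); by rewrite /GRing.scale/= mulr1.
  by have := @is_derive1_comp _ expR (fun x => - c * x) x _ _ (is_derive_expR _) H; rewrite mulrC.
pose phi x := E x * y x - k * I x.
have dphi x : x \in `]0, T[ -> is_derive x 1 phi (E x * y' x + y x * (- c * E x) - k * G x).
  move=> xT; have [dy _] := Hy x xT.
  have cGx : {for x, continuous G}.
    have [x0 xT'] : 0 < x /\ x < T by move: xT; rewrite in_itv/= => /andP[].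
    by move/(continuous_within_itvP _ (lt_trans x0 xT')): cG => [cG _ _]; exact: cG.
  have [x0 xT'] : 0 < x /\ x < T by move: xT; rewrite in_itv/= => /andP[].
  have [dI eI] := continuous_FTC1_closed xT' iG x0 cGx.
  have dI' : is_derive x 1 I (G x) by apply: DeriveDef; [exact: dI|rewrite -derive1E; exact: eI].
  exact: (is_deriveB (is_deriveM (dE x) dy) (is_deriveZ k dI')).
have phit : phi t <= phi 0.
  apply: (@ler0_derive1_le_cc _ phi 0 T).
  - by move=> x xT; have [] := dphi x xT.
  - move=> x xT; rewrite derive1E; have [_ ->] := dphi x xT; have [_ yx] := Hy x xT.
    have Ex : 0 < E x by exact: expR_gt0.
    have E1 : E x <= 1.
      rewrite /E -expR0 ler_expR mulNr oppr_le0 mulr_ge0//.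
      by move: xT; rewrite in_itv/= => /andP[/ltW].
    have Gx : 0 <= G x.
      by apply: G0; apply: subset_itv_oo_cc.
    have h1 : E x * y' x <= E x * (c * y x + k * G x) by rewrite ler_pM2l.
    have h2 : E x * (k * G x) <= 1 * (k * G x) by rewrite ler_wpM2r// mulr_ge0.
    by nra.
  - move=> x; apply: cvgB; last first.
      by apply: cvgM; [exact: cvg_cst|exact: cI].
    apply: cvgM; last exact: cy.
    have cE : continuous E.
      by move=> z; apply: differentiable_continuous; apply/derivable1_diffP; have [] := dE z.
    by have := continuous_subspaceT cE; apply.
  - exact: tT.
  - by rewrite in_itv/= lexx.
  - exact: t0.
have phi0 : phi 0 <= 0.
  rewrite /phi /I /parameterized_integral set_itv1 Rintegral_set1 mulr0 subr0.
  by rewrite /E mulr0 expR0 mul1r.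
have : E t * y t <= k * I t by have := le_trans phit phi0; rewrite subr_le0.
have I0 : 0 <= I t.
  apply: Rintegral_ge0 => x /=; rewrite in_itv/= => /andP[x0 xt]; apply: G0.
  by rewrite in_itv/= x0 (le_trans xt).
move=> h; rewrite -mulrA.
have e1 : y t = expR (c * t) * (E t * y t).
  by rewrite mulrA /E -expRD mulNr subrr expR0 mul1r.
rewrite e1; apply: (@le_trans _ _ (expR (c * t) * (k * I t))).
  by rewrite ler_pM2l ?expR_gt0.
apply: ler_wpM2r; first by rewrite mulr_ge0.
by rewrite ler_expR ler_wpM2l.
Qed.

End OneVariableCalculus.

(** * Functions on the space-time rectangle *)

Section SpaceTime.
Variable R : realType.
Local Notation mu := (@lebesgue_measure R).
Local Notation D := (@D01 R).
Implicit Types (F G u : R -> R -> R) (x t s T e : R).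

Definition rect_continuous T F :=
  {within `[0, T] `*` `[0, 1], continuous (fun p : R * R => F p.1 p.2)}.

(** Uniformity in x is the compactness of [0, 1] (tube lemma). *)
Lemma rect_continuous_near T F t e : rect_continuous T F -> t \in `[0, T] -> 0 < e ->
  exists2 r, 0 < r & forall s, `|t - s| < r -> s \in `[0, T] ->
    forall x, x \in `[0, 1] -> `|F s x - F t x| <= e.
Proof.
move=> cF tT e0.
have /near_covering_withinP cov := (compact_near_coveringP `[(0:R), 1]%classic).1
  (@segment_compact R 0 1).
have /(_ _)[] := cov R (nbhs t) (fun s x => s \in `[0, T] -> `|F s x - F t x| <= e) _ _.
  move=> x x01.
  have /subspace_continuousP/(_ (t, x) (conj tT x01))/cvgrPdist_le := cF.
  have e2 : 0 < e / 2 by rewrite divr_gt0.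
  move=> /(_ _ e2) [[A1 A2] /= [nA1 nA2] HA].
  exists (A2, A1) => //= -[x' s] /= [A2x' A1s] x'01 sT.
  have h1 := HA (s, x') (conj A1s A2x') (conj sT x'01).
  have h2 := HA (t, x') (conj (nbhs_singleton nA1) A2x') (conj tT x'01).
  rewrite /= in h1 h2.
  rewrite (_ : F s x' - F t x' = (F t x - F t x') - (F t x - F s x')); last by ring.
  by apply: le_trans (ler_normB _ _) _; rewrite [e]splitr lerD.
move=> r /= r0 Hr; exists r => // s sr sT x x01.
by apply: Hr => //=.
Qed.

Lemma rect_continuous_slice T F t : rect_continuous T F -> t \in `[0, T] ->
  {within `[0, 1], continuous (F t)}.
Proof.
move=> cF tT; apply/subspace_continuousP => x x01.
apply/cvgrPdist_le => e e0.
have /subspace_continuousP/(_ (t, x) (conj tT x01))/cvgrPdist_le/(_ _ e0) := cF.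
move=> [[A1 A2] /= [nA1 nA2] HA]; apply: filterS nA2 => x' A2x' x'01.
exact: (HA (t, x') (conj (nbhs_singleton nA1) A2x') (conj tT x'01)).
Qed.

Lemma rect_L2 T F t : rect_continuous T F -> t \in `[0, T] -> L2 (F t).
Proof. by move=> cF tT; apply: L2_continuous; exact: rect_continuous_slice cF tT. Qed.

Lemma rect_L2norm_continuous T F : rect_continuous T F ->
  {within `[0, T], continuous (fun t => L2norm (F t))}.
Proof.
move=> cF; apply/subspace_continuousP => t tT; apply/cvgrPdist_le => e e0.
have [r r0 Hr] := rect_continuous_near cF tT e0.
exists r => //= s /= sr sT.
have Ls := rect_L2 cF sT; have Lt := rect_L2 cF tT.
have H (v w : R -> R) : L2 v -> L2 w -> L2norm v - L2norm w <= L2norm (v \- w).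
  move=> Lv Lw; rewrite lerBlDr; apply: le_trans (L2normD (L2B Lv Lw) Lw).
  by rewrite (_ : (v \- w) \+ w = v)//; apply/funext => x /=; rewrite subrK.
have b : L2norm (F s \- F t) <= e.
  apply: L2norm_le_bound; [exact: ltW|exact: L2B|].
  by move=> x /D01_cc Dx /=; exact: Hr.
rewrite ler_norml; apply/andP; split.
  by rewrite lerNl opprB; apply: le_trans b; exact: H.
by apply: le_trans b; rewrite L2normN; exact: H.
Qed.

Lemma C_tx_rect T m n F i j : C_tx T m n F -> (i <= m)%N -> (j <= n)%N ->
  rect_continuous T (dtx T i j F).
Proof. by move=> H im jn; have [] := H i j im jn. Qed.

Lemma C_tx_dx T m n F i j t : C_tx T m n F -> (i <= m)%N -> (j < n)%N -> t \in `[0, T] ->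
  C1_deriv (dtx T i j F t) (dtx T i j.+1 F t).
Proof.
move=> H im jn tT; have [_ _ dF] := H i j im (ltnW jn); split.
- exact: rect_continuous_slice (C_tx_rect H im (ltnW jn)) tT.
- exact: rect_continuous_slice (C_tx_rect H im jn) tT.
- move=> x x01; apply: (@diff_quot_is_derive _ _ 0 1) => //.
  by apply: dF => //; exact: D01_cc.
Qed.

Lemma C_tx_dt T m n F i j t x : C_tx T m n F -> (i < m)%N -> (j <= n)%N ->
  t \in `[0, T] -> x \in `[0, 1] ->
  diff_quot (fun s => dtx T i j F s x) t @ within `[0, T] t^' --> dtx T i.+1 j F t x.
Proof.
move=> H im jn tT x01; have [_ dF _] := H i j (ltnW im) jn.
exact: (dF im t x tT x01).
Qed.

(** By the mean value theorem in time, a difference quotient of F at x is a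
    value of G at x at a nearby time. *)
Lemma diff_quot_uniform T F G t e : rect_continuous T G ->
  (forall s x, s \in `[0, T] -> x \in `[0, 1] ->
     diff_quot (F^~ x) s @ within `[0, T] s^' --> G s x) ->
  t \in `[0, T] -> 0 < e ->
  exists2 r, 0 < r & forall s, `|t - s| < r -> s != t -> s \in `[0, T] ->
    forall x, x \in `[0, 1] -> `|(F s x - F t x) / (s - t) - G t x| <= e.
Proof.
move=> cG dF tT e0; have [r r0 Hr] := rect_continuous_near cG tT e0.
exists r => // s sr st sT x x01.
have cF : {within `[0, T], continuous (F^~ x)}.
  by apply: (@diff_quot_within_continuous _ _ _ _ (G^~ x)) => z zT; exact: dF.
have mvt a b : a < b -> a \in `[0, T] -> b \in `[0, T] ->
    exists2 c, a < c < b & F b x - F a x = G c x * (b - a).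
  rewrite !in_itv/= => ab /andP[a0 aT] /andP[b0 bT].
  have [||c] := @MVT _ (F^~ x) (G^~ x) a b ab.
  - move=> c; rewrite in_itv/= => /andP[ac cb]; apply: (@diff_quot_is_derive _ _ 0 T).
      by rewrite in_itv/=; apply/andP; split; lra.
    by apply: dF => //; rewrite in_itv/=; apply/andP; split; lra.
  - apply: continuous_subspaceW cF => z /=; rewrite !in_itv/= => /andP[az zb].
    by apply/andP; split; lra.
  by rewrite in_itv/= => cab E; exists c.
have [c cr [cT ->]] : exists2 c, `|t - c| < r &
    c \in `[0, T] /\ (F s x - F t x) / (s - t) = G c x.
  have st0 : s - t != 0 by rewrite subr_eq0.
  have [lt|lt|E] := ltgtP s t; last by rewrite E eqxx in st.
  - have [c /andP[sc ct] E] := mvt _ _ lt sT tT; exists c.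
      by move: sr; rewrite !ltr_norml => /andP[? ?]; apply/andP; split; lra.
    split; last by rewrite -opprB E -mulrN opprB mulfK.
    by move: sT tT; rewrite !in_itv/= => /andP[? ?] /andP[? ?]; apply/andP; split; lra.
  - have [c /andP[tc cs] E] := mvt _ _ lt tT sT; exists c.
      by move: sr; rewrite !ltr_norml => /andP[? ?]; apply/andP; split; lra.
    split; last by rewrite E mulfK.
    by move: sT tT; rewrite !in_itv/= => /andP[? ?] /andP[? ?]; apply/andP; split; lra.
exact: Hr.
Qed.

Lemma C1_deriv_lin (c : R) (v w dv dw : R -> R) : C1_deriv v dv -> C1_deriv w dw ->
  C1_deriv (fun x => c * v x + w x) (fun x => c * dv x + dw x).
Proof.
move=> [cv cdv hv] [cw cdw hw]; split.
- by move=> x; apply: cvgD; [apply: cvgM; [exact: cvg_cst|exact: cv]|exact: cw].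
- by move=> x; apply: cvgD; [apply: cvgM; [exact: cvg_cst|exact: cdv]|exact: cdw].
- by move=> x Dx; exact: (is_deriveD (is_deriveZ c (hv x Dx)) (hw x Dx)).
Qed.

(** For classical functions, the energy is computed with the classical
    derivative. *)
Lemma C1_deriv_energy (v d : R -> R) : C1_deriv v d -> energy_norm v = L2norm d.
Proof.
move=> H; have [_ cd _] := H; apply: ae_eq_L2norm; [exact: wderiv_L2|exact: L2_continuous|].
exact: wderiv_ae (C1_deriv_weak H).
Qed.

End SpaceTime.

(** * The energy estimate *)

Section EnergyMethod.
Variable R : realType.
Local Notation mu := (@lebesgue_measure R).
Local Notation D := (@D01 R).
Implicit Types (v w z : R -> R) (x t s T e : R).

(** w' t is the derivative at t of w, seen as a curve in the energy space. *)
Definition energy_derivative T (w w' : R -> R -> R) t :=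
  energy_norm (fun x => (w s x - w t x) / (s - t) - w' t x)
    @[s --> within `[0, T] t^'] --> (0 : R).

Lemma HH1_diff_quot w1 w2 w' (d : R) : HH 1 w1 -> HH 1 w2 -> HH 1 w' ->
  HH 1 (fun x => (w1 x - w2 x) / d - w' x).
Proof.
move=> H1 H2 H'; have := HH1B (HH1Z d^-1 (HH1B H1 H2)) H'.
rewrite (_ : _ \- _ = fun x => (w1 x - w2 x) / d - w' x)//.
by apply/funext => x /=; rewrite mulrC.
Qed.

Section Forms.
Variable b : (R -> R) -> (R -> R) -> R.
Hypothesis b_lin : forall c v w z, HH 1 v -> HH 1 w -> HH 1 z ->
  b (fun x => c * v x + w x) z = c * b v z + b w z.
Hypothesis b_sym : forall v w, b v w = b w v.
Hypothesis b_bound : forall v w, HH 1 v -> HH 1 w ->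
  `|b v w| <= energy_norm v * energy_norm w.

(** Write w s = w t + (s - t) (w' t + E s) with E s small in energy, and expand
    b. *)
Lemma quadratic_diff_quot T (w w' : R -> R -> R) t :
  (forall s, s \in `[0, T] -> HH 1 (w s)) -> t \in `[0, T] -> HH 1 (w' t) ->
  energy_derivative T w w' t ->
  diff_quot (fun s => b (w s) (w s)) t @ within `[0, T] t^' --> 2 * b (w' t) (w t).
Proof.
move=> Hw tT Hw't dw; have Hwt := Hw t tT.
pose E s := fun x => (w s x - w t x) / (s - t) - w' t x.
have HE s : s \in `[0, T] -> HH 1 (E s).
  by move=> sT; apply: HH1_diff_quot; [exact: Hw|exact: Hwt|exact: Hw't].
pose g s := `|s - t| * (energy_norm (E s) + energy_norm (w' t)) ^+ 2 +
  2 * (energy_norm (E s) * energy_norm (w t)).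
have g0 : g s @[s --> within `[0, T] t^'] --> (0 : R).
  have c1 : `|s - t| @[s --> within `[0, T] t^'] --> (0 : R).
    rewrite -[X in _ --> X](normr0 R) -[X in `|X|](subrr t).
    apply: cvg_norm; apply: cvgB; last exact: cvg_cst.
    apply: cvg_trans (@nbhs_dnbhs _ t); exact: cvg_within.
  have c2 : energy_norm (E s) @[s --> within `[0, T] t^'] --> (0 : R) := dw.
  have z0 (n1 n2 : R) : 0 * (0 + n1) ^+ 2 + 2 * (0 * n2) = 0 by rewrite !mul0r mulr0 addr0.
  rewrite -[X in _ --> X](z0 (energy_norm (w' t)) (energy_norm (w t))) /g.
  apply: cvgD.
    apply: cvgM; first exact: c1.
    by apply: cvgM; apply: cvgD; [exact: c2|exact: cvg_cst|exact: c2|exact: cvg_cst].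
  apply: cvgM; first exact: cvg_cst.
  by apply: cvgM; [exact: c2|exact: cvg_cst].
apply/cvgrPdist_le => e e0.
move/cvgrPdist_le : g0 => /(_ e e0).
rewrite !near_withinE; apply: filterS => s gs st0 sT.
have st : s - t != 0 by rewrite subr_eq0.
move: gs => /(_ st0 sT); rewrite sub0r normrN => gs.
have HEs := HE s sT; have Hws := Hw s sT.
apply: le_trans (le_trans (ler_norm _) gs).
pose P := fun x => 1 * E s x + w' t x.
have HP : HH 1 P by apply: HH1_lin; [exact: HEs|exact: Hw't].
have wsE : w s = fun x => (s - t) * P x + w t x.
  by apply/funext => x; rewrite /P /E mul1r subrK mulrCA mulfV// mulr1 subrK.
have bE : b (w s) (w s) = (s - t) ^+ 2 * b P P + 2 * (s - t) * b P (w t) + b (w t) (w t).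
  rewrite {1}wsE (b_lin _ HP Hwt Hws) (b_sym P) (b_sym (w t)) wsE.
  rewrite !(b_lin _ HP Hwt) ?(b_sym (w t) P); [|exact: Hwt|exact: HP].
  by ring.
have qE : diff_quot (fun s => b (w s) (w s)) t s = (s - t) * b P P + 2 * b P (w t).
  by rewrite /diff_quot bE; field.
have bPE : b P (w t) = b (E s) (w t) + b (w' t) (w t).
  by rewrite (b_lin 1 HEs Hw't Hwt) mul1r.
rewrite qE bPE (_ : _ - _ = - ((s - t) * b P P + 2 * b (E s) (w t))); last by ring.
rewrite normrN; apply: le_trans (ler_normD _ _) _.
have NP : energy_norm P <= energy_norm (E s) + energy_norm (w' t).
  have -> : P = E s \+ w' t by apply/funext => x; rewrite /P mul1r.
  by apply: energy_normD; [exact: HEs|exact: Hw't].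
rewrite /g; apply: lerD; rewrite normrM.
  apply: ler_wpM2l => //; apply: le_trans (b_bound HP HP) _.
  rewrite -expr2 lerXn2r ?nnegrE ?energy_norm_ge0//.
  by rewrite addr_ge0 ?energy_norm_ge0.
by rewrite (ger0_norm (ler0n R 2)); apply: (ler_wpM2l (ler0n R 2)); exact: b_bound.
Qed.

End Forms.

Lemma energy_diff_quot T (w w' : R -> R -> R) t :
  (forall s, s \in `[0, T] -> HH 1 (w s)) -> t \in `[0, T] -> HH 1 (w' t) ->
  energy_derivative T w w' t ->
  [/\ diff_quot (fun s => B (w s) (w s)) t @ within `[0, T] t^' --> 2 * B (w' t) (w t),
      diff_quot (fun s => ip (w s) (w s)) t @ within `[0, T] t^' --> 2 * ip (w' t) (w t) &
      diff_quot (fun s => w s 1 * w s 1) t @ within `[0, T] t^' --> 2 * (w' t 1 * w t 1)].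
Proof.
move=> Hw tT Hw' dw; split.
- refine (@quadratic_diff_quot (@B R) _ _ _ T w w' t Hw tT Hw' dw).
  + by move=> c v z y Hv Hz _; exact: B_lin.
  + exact: B_sym.
  + by move=> v z _ _; exact: B_CS.
- refine (@quadratic_diff_quot (@ip R) _ _ _ T w w' t Hw tT Hw' dw).
  + by move=> c v z y Hv Hz Hy; apply: ip_linl; exact: HH1_L2.
  + exact: ipC.
  + move=> v z Hv Hz; apply: le_trans (ip_CS (HH1_L2 Hv) (HH1_L2 Hz)) _.
    by apply: ler_pM; [exact: L2norm_ge0|exact: L2norm_ge0|exact: poincare|exact: poincare].
- refine (@quadratic_diff_quot (fun v z => v 1 * z 1) _ _ _ T w w' t Hw tT Hw' dw).
  + by move=> c v z y _ _ _; rewrite mulrDl mulrA.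
  + by move=> v z; rewrite mulrC.
  + move=> v z Hv Hz; rewrite normrM.
    by apply: ler_pM; [exact: normr_ge0|exact: normr_ge0|exact: HH1_endpoint_le
      |exact: HH1_endpoint_le].
Qed.

(** The mixed terms are linear in X; by Young's inequality they are absorbed by
    the term - 2 X^2. *)
Lemma energy_arith (M K a' d' n2 n q l X H H' iX ib1 ib2 ie e t1 : R) :
  0 <= M -> 0 <= K -> 0 <= n -> 0 <= X -> 0 <= H -> 0 <= H' ->
  n2 = n ^+ 2 -> `|a'| <= M -> `|d'| <= M -> q <= n ^+ 2 -> 0 <= q -> l <= n -> 0 <= l ->
  iX <= X * l -> ib1 <= M * l * X -> ib2 <= M * H * X -> - ie <= H' * X -> e * t1 ^+ 2 <= 0 ->
  a' * n2 - d' * q + 2 * K * iX + 2 * (e * t1 ^+ 2 + ib1 + ib2 - ie - X ^+ 2)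
   <= (2 * M + 2 * (K + M) ^+ 2) * n ^+ 2 + 2 * (M ^+ 2 + 1) * (H ^+ 2 + H' ^+ 2).
Proof.
move=> M0 K0 n0 X0 H0 H'0 -> aM dM qn q0 ln l0 hX h1 h2 h3 he.
have t1' : a' * n ^+ 2 <= M * n ^+ 2.
  by rewrite ler_wpM2r ?sqr_ge0//; exact: le_trans (ler_norm _) aM.
have t2 : - d' * q <= M * n ^+ 2.
  apply: (@le_trans _ _ (M * q)); last by rewrite ler_wpM2l.
  by rewrite ler_wpM2r//; apply: le_trans dM; rewrite -normrN; exact: ler_norm.
have t3 : K * iX <= K * (X * n).
  by rewrite ler_wpM2l//; apply: le_trans hX _; rewrite ler_wpM2l.
have t4 : ib1 <= M * n * X.
  by apply: le_trans h1 _; rewrite ler_wpM2r// ler_wpM2l.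
(* The coefficients of X that come from theta and from eta. *)
pose Y := (K + M) * n; pose Z := M * H + H'.
have s1 : 2 * (Y * X) <= 2 * Y ^+ 2 + X ^+ 2 / 2 by have := sqr_ge0 (2 * Y - X); lra.
have s2 : 2 * (Z * X) <= Z ^+ 2 + X ^+ 2 by have := sqr_ge0 (Z - X); lra.
have s3 : Z ^+ 2 <= 2 * (M ^+ 2 + 1) * (H ^+ 2 + H' ^+ 2).
  have m2 := mulr_ge0 (sqr_ge0 M) (sqr_ge0 H').
  have := sqr_ge0 (M * H - H'); have := sqr_ge0 H; rewrite /Z; nra.
have s4 : 2 * Y ^+ 2 = 2 * (K + M) ^+ 2 * n ^+ 2 by rewrite /Y exprMn mulrA.
have s5 : 2 * (Y * X) = 2 * K * (X * n) + 2 * (M * n * X) by rewrite /Y; ring.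
have s6 : 2 * (Z * X) = 2 * (M * H * X) + 2 * (H' * X) by rewrite /Z; ring.
have := sqr_ge0 X; lra.
Qed.

(** Test the error equation with theta'. The term with eps has a favourable
    sign, and delta theta(1) theta'(1) is half the time derivative of
    delta theta(1)^2 up to lower order. This suggests the energy
    y = a B theta theta - delta theta(1)^2 + K ip theta theta, where K is so
    large that, by the hypothesis on traces, y controls the energy norm of
    theta. The bound of y' by y and the data of eta is then integrated by
    Gronwall's inequality. *)
Lemma energy_estimate T (a da delta ddelta eps : R -> R) (beta : R -> R -> R)
    (theta theta' eta eta' : R -> R -> R) (G : R -> R) (a0 M K k : R) :
  0 <= T -> 0 < a0 -> 0 <= M -> 0 <= K -> 0 <= k ->
  (forall v, HH 1 v -> M * v 1 ^+ 2 <= a0 / 2 * energy_norm v ^+ 2 + K * L2norm v ^+ 2) ->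
  (forall t, t \in `[0, T] -> [/\ a0 <= a t, `|da t| <= M, `|delta t| <= M, `|ddelta t| <= M &
    eps t <= 0]) ->
  (forall t, t \in `[0, T] -> diff_quot a t @ within `[0, T] t^' --> da t) ->
  (forall t, t \in `[0, T] -> diff_quot delta t @ within `[0, T] t^' --> ddelta t) ->
  (forall t, t \in `[0, T] -> {within `[0, 1], continuous (beta t)} /\
      forall x, x \in `[0, 1] -> `|beta t x| <= M) ->
  (forall t, t \in `[0, T] -> [/\ HH 1 (theta t), HH 1 (theta' t), HH 1 (eta t) & HH 1 (eta' t)]) ->
  (forall t, t \in `[0, T] -> energy_derivative T theta theta' t) ->
  energy_norm (theta 0) = 0 ->
  (forall t, t \in `[0, T] ->
     ip (theta' t) (theta' t) + ip (eta' t) (theta' t) =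
       (eps t * theta' t 1 + delta t * theta t 1) * theta' t 1
       - a t * B (theta t) (theta' t)
       + ip (fun x => beta t x * theta t x) (theta' t)
       + ip (fun x => beta t x * eta t x) (theta' t)) ->
  {within `[0, T], continuous G} ->
  (forall t, t \in `[0, T] -> L2norm (eta t) ^+ 2 + L2norm (eta' t) ^+ 2 <= k * G t /\ 0 <= G t) ->
  forall t, t \in `[0, T] ->
    a0 / 2 * energy_norm (theta t) ^+ 2 <=
      expR ((2 / a0 * (2 * M + 2 * (K + M) ^+ 2)) * T) * (2 * (M ^+ 2 + 1) * k) *
      \int[mu]_(s in `[0, t]) G s.
Proof.
move=> T0 a0p M0 K0 k0 trace bnd da_ dd_ bet HHs dtheta theta0 eqn cG etaG.
pose y t := a t * B (theta t) (theta t) - delta t * (theta t 1 * theta t 1)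
  + K * ip (theta t) (theta t).
pose y' t := (a t * (2 * B (theta' t) (theta t)) + B (theta t) (theta t) * da t)
  - (delta t * (2 * (theta' t 1 * theta t 1)) + (theta t 1 * theta t 1) * ddelta t)
  + K * (2 * ip (theta' t) (theta t)).
have Hth t : t \in `[0, T] -> HH 1 (theta t) by move=> /HHs[].
have dq t : t \in `[0, T] -> _ :=
  fun tT => let: And4 H1 H2 _ _ := HHs t tT in energy_diff_quot Hth tT H2 (dtheta t tT).
have y_ge t : t \in `[0, T] -> a0 / 2 * energy_norm (theta t) ^+ 2 <= y t.
  move=> tT; have [ha _ hd _ _] := bnd t tT; have tr := trace _ (Hth t tT).
  have b1 : a0 * energy_norm (theta t) ^+ 2 <= a t * B (theta t) (theta t).
    by rewrite -sqr_energy_norm; apply: ler_wpM2r; [exact: sqr_ge0|exact: ha].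
  have b2 : delta t * (theta t 1 * theta t 1) <= M * theta t 1 ^+ 2.
    by rewrite -expr2; apply: ler_wpM2r; [exact: sqr_ge0|exact: le_trans (ler_norm _) hd].
  have b3 : K * ip (theta t) (theta t) = K * L2norm (theta t) ^+ 2 by rewrite sqr_L2norm.
  rewrite /y b3; move: tr b1 b2.
  move: (energy_norm (theta t)) (L2norm (theta t)) (theta t 1) (B _ _) => n l t1 b.
  move=> *; lra.
have dy t : t \in `]0, T[ -> is_derive t 1 y (y' t).
  move=> tT; have tT' : t \in `[0, T] by apply: subset_itv_oo_cc.
  have [q1 q2 q3] := dq t tT'.
  have D1 := diff_quot_is_derive tT (da_ t tT').
  have D2 := diff_quot_is_derive tT (dd_ t tT').
  have D3 := diff_quot_is_derive tT q1.
  have D4 := diff_quot_is_derive tT q2.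
  have D5 := diff_quot_is_derive tT q3.
  exact: (is_deriveD (is_deriveB (is_deriveM D1 D3) (is_deriveM D2 D5)) (is_deriveZ K D4)).
have cy : {within `[0, T], continuous y}.
  have c1 := diff_quot_within_continuous da_.
  have c2 := diff_quot_within_continuous dd_.
  have c3 : {within `[0, T], continuous (fun t => B (theta t) (theta t))}.
    by apply: (@diff_quot_within_continuous _ _ _ _ (fun t => 2 * B (theta' t) (theta t))) => t
      /dq[].
  have c4 : {within `[0, T], continuous (fun t => ip (theta t) (theta t))}.
    by apply: (@diff_quot_within_continuous _ _ _ _ (fun t => 2 * ip (theta' t) (theta t))) =>
      t /dq[].
  have c5 : {within `[0, T], continuous (fun t => theta t 1 * theta t 1)}.
    by apply: (@diff_quot_within_continuous _ _ _ _ (fun t => 2 * (theta' t 1 * theta t 1))) =>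
      t /dq[].
  move=> t; apply: cvgD; last by apply: cvgM; [exact: cvg_cst|exact: c4].
  by apply: cvgB; apply: cvgM; [exact: c1|exact: c3|exact: c2|exact: c5].
set c := 2 / a0 * _.
have c0 : 0 <= c.
  apply: mulr_ge0; first by rewrite divr_ge0// ltW.
  by apply: addr_ge0; apply: mulr_ge0 => //; exact: sqr_ge0.
have aux (Q n2 z : R) : 0 <= Q -> a0 / 2 * n2 <= z -> Q * n2 <= 2 / a0 * Q * z.
  move=> Q0 h; rewrite (_ : Q * n2 = 2 / a0 * Q * (a0 / 2 * n2)); last first.
    by field; rewrite gt_eqF.
  by apply: ler_wpM2l h; apply: mulr_ge0 Q0; rewrite divr_ge0// ltW.
have k1 : 0 <= 2 * (M ^+ 2 + 1) * k.
  by rewrite mulr_ge0// mulr_ge0// addr_ge0 ?sqr_ge0.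
have y0 : y 0 <= 0.
  have H0 : HH 1 (theta 0) by apply: Hth; rewrite in_itv/= lexx.
  have b0 : B (theta 0) (theta 0) = 0 by rewrite -sqr_energy_norm theta0 expr0n.
  have l0 : L2norm (theta 0) = 0.
    by have h := poincare H0; rewrite theta0 in h; apply/eqP; rewrite eq_le h L2norm_ge0.
  have e0 : theta 0 1 = 0.
    by have h := HH1_endpoint_le H0; rewrite theta0 normr_le0 in h; exact/eqP.
  by rewrite /y b0 e0 -sqr_L2norm l0 expr0n/= !mulr0 subrr addr0.
have y'_le t : t \in `]0, T[ -> y' t <= c * y t + 2 * (M ^+ 2 + 1) * k * G t.
  move=> tT; have tT' : t \in `[0, T] by apply: subset_itv_oo_cc.
  have [H1 H2 H3 H4] := HHs t tT'; have [ha hda hd hdd he] := bnd t tT'.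
  have [cb hb] := bet t tT'; have eq1 := eqn t tT'; have [eG G0] := etaG t tT'.
  have mb : measurable_fun D (beta t) by apply: L2_measurable; exact: L2_continuous.
  have hbD x : D x -> `|beta t x| <= M by move=> /D01_cc; exact: hb.
  have L1 := HH1_L2 H1; have L2' := HH1_L2 H2; have L3 := HH1_L2 H3; have L4 := HH1_L2 H4.
  have i1 : ip (fun x => beta t x * theta t x) (theta' t) <= M * L2norm (theta t) * L2norm
    (theta' t).
    apply: le_trans (ip_le (L2_mul_bounded L1 mb hbD) L2') _.
    by apply: ler_wpM2r; [exact: L2norm_ge0|exact: L2norm_mul_bounded].
  have i2 : ip (fun x => beta t x * eta t x) (theta' t) <= M * L2norm (eta t) * L2norm (theta' t).
    apply: le_trans (ip_le (L2_mul_bounded L3 mb hbD) L2') _.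
    by apply: ler_wpM2r; [exact: L2norm_ge0|exact: L2norm_mul_bounded].
  have i3 : - ip (eta' t) (theta' t) <= L2norm (eta' t) * L2norm (theta' t).
    by apply: le_trans (ip_CS L4 L2'); rewrite -normrN; exact: ler_norm.
  have i4 : ip (theta' t) (theta t) <= L2norm (theta' t) * L2norm (theta t) := ip_le L2' L1.
  have i5 : theta t 1 * theta t 1 <= energy_norm (theta t) ^+ 2.
    by rewrite -expr2; apply: ler_sqr_norm; exact: HH1_endpoint_le.
  have i6 : eps t * theta' t 1 ^+ 2 <= 0 by rewrite mulr_le0_ge0// sqr_ge0.
  have i7 : 0 <= theta t 1 * theta t 1 by rewrite -expr2 sqr_ge0.
  have p := poincare H1; have n0 := energy_norm_ge0 (theta t).
  have l0 := L2norm_ge0 (theta t); have X0 := L2norm_ge0 (theta' t).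
  have h0 := L2norm_ge0 (eta t); have h'0 := L2norm_ge0 (eta' t).
  have := energy_arith M0 K0 n0 X0 h0 h'0 (esym (sqr_energy_norm (theta t))) hda hdd i5 i7 p l0
    i4 i1 i2 i3 i6.
  have yt := y_ge t tT'.
  have n2 : (2 * M + 2 * (K + M) ^+ 2) * energy_norm (theta t) ^+ 2 <= c * y t.
    by apply: aux yt; apply: addr_ge0; apply: mulr_ge0 => //; exact: sqr_ge0.
  have g2 : 2 * (M ^+ 2 + 1) * (L2norm (eta t) ^+ 2 + L2norm (eta' t) ^+ 2) <= 2 * (M ^+ 2 + 1)
    * k * G t.
    by rewrite -[leRHS]mulrA; apply: ler_wpM2l; [rewrite mulr_ge0// addr_ge0 ?sqr_ge0|exact: eG].
  move=> H; apply: le_trans (le_trans H (lerD n2 g2)).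
  rewrite le_eqVlt; apply/orP; left; apply/eqP.
  have Xe : L2norm (theta' t) ^+ 2 = ip (theta' t) (theta' t) := sqr_L2norm _.
  rewrite Xe /y'.
  have -> : a t * (2 * B (theta' t) (theta t)) = 2 * (a t * B (theta t) (theta' t)).
    by rewrite (B_sym (theta' t)) mulrCA.
  have -> : a t * B (theta t) (theta' t) =
     (eps t * theta' t 1 + delta t * theta t 1) * theta' t 1
       + ip (fun x => beta t x * theta t x) (theta' t)
       + ip (fun x => beta t x * eta t x) (theta' t) - ip (eta' t) (theta' t) - ip (theta' t)
         (theta' t).
    have -> : ip (theta' t) (theta' t) = ip (theta' t) (theta' t) + ip (eta' t) (theta' t) - ip
      (eta' t) (theta' t) by rewrite addrK.
    rewrite eq1; ring.
  by ring.
move=> t tT; apply: le_trans (y_ge t tT) _.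
apply: (@gronwall _ T y y' G c (2 * (M ^+ 2 + 1) * k) c0 k1 cy cG) => //.
- by move=> s /etaG[].
- by move=> s sT; split; [exact: dy|exact: y'_le].
Qed.

End EnergyMethod.

(** * Consequences of the smoothness assumptions *)

Section DataBounds.
Variable R : realType.
Implicit Types (v : R -> R) (F u : R -> R -> R) (x t s T e : R).

Lemma smooth_onP (A : set R) v : smooth_on A v ->
  [/\ {within A, continuous v}, {within A, continuous (derive_in A v)} &
      forall t, A t -> diff_quot v t @ within A t^' --> derive_in A v t].
Proof.
move=> H; have [c0 d0] := H 0%N; have [c1 _] := H 1%N; split.
- exact: c0.
- exact: c1.
- by move=> t At; exact: d0.
Qed.

Lemma segment_bounded T v : 0 <= T -> {within `[0, T], continuous v} ->
  exists2 M, 0 <= M & forall t, t \in `[0, T] -> `|v t| <= M.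
Proof.
move=> T0 cv; have [|c _ H] := EVT_max (f := fun x => `|v x|) T0.
  by move=> x; apply: cvg_norm; exact: cv.
by exists `|v c|.
Qed.

Lemma rect_bounded T F : rect_continuous T F ->
  exists2 M, 0 <= M & forall t x, t \in `[0, T] -> x \in `[0, 1] -> `|F t x| <= M.
Proof.
move=> cF.
have cK : compact (`[0, T]%classic `*` `[(0 : R), 1]%classic).
  by apply: compact_setX; exact: segment_compact.
have [M0 [_ HM]] := compact_bounded (continuous_compact cF cK).
exists (`|M0| + 1); first by rewrite addr_ge0.
move=> t x tT x01; apply: (HM (`|M0| + 1)); first by rewrite ltr_pwDr ?ler_norm.
by exists (t, x).
Qed.

(** The difference quotients in time vanish, and so does their limit, since t
    is an accumulation point of [0, T]. *)
Lemma dt_vanish T m n u t x : C_tx T m n u -> (0 < m)%N -> 0 < T ->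
  x \in `[0, 1] -> (forall s, s \in `[0, T] -> u s x = 0) -> t \in `[0, T] ->
  dt T u t x = 0.
Proof.
move=> Cu m0 T0 x01 u0 tT.
have /diff_quotP H := C_tx_dt Cu m0 (leq0n n) tT x01.
apply/eqP; rewrite -normr_le0; apply/ler_addgt0Pl => e e0; rewrite addr0.
have [r r0 Hr] := H e e0.
have [t0 t1] : 0 <= t /\ t <= T by move: tT; rewrite in_itv/= => /andP[].
have [s [sr st sT]] : exists s, [/\ `|t - s| < r, s != t & s \in `[0, T]].
  have [tlt|tge] := ltP t T.
    pose d := Num.min r (T - t).
    have d0 : 0 < d by rewrite lt_min r0 subr_gt0.
    have dr : d <= r by rewrite ge_min lexx.
    have dT : d <= T - t by rewrite ge_min lexx orbT.
    exists (t + d / 2); split.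
    - by rewrite opprD addrA subrr sub0r normrN gtr0_norm; lra.
    - by rewrite -subr_eq0 (_ : _ - _ = d / 2) ?gt_eqF; lra.
    - by rewrite in_itv/=; apply/andP; split; lra.
  pose d := Num.min r T.
  have d0 : 0 < d by rewrite lt_min r0.
  have dr : d <= r by rewrite ge_min lexx.
  have dT : d <= T by rewrite ge_min lexx orbT.
  exists (t - d / 2); split.
  - by rewrite opprB addrA addrAC subrr add0r gtr0_norm; lra.
  - by rewrite -subr_eq0 (_ : _ - _ = - (d / 2)) ?lt_eqF; lra.
  - by rewrite in_itv/=; apply/andP; split; lra.
have := Hr s sr st sT; rewrite /diff_quot /dtx /= !u0// subrr mul0r subr0.
exact.
Qed.

Lemma HH_dtx T m n F i t : C_tx T m n F -> (i <= m)%N -> t \in `[0, T] ->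
  dtx T i 0 F t 0 = 0 ->
  HH n (dtx T i 0 F t) /\
  Hnorm n (dtx T i 0 F t) = Num.sqrt (\sum_(l < n.+1) L2norm (dtx T i l F t) ^+ 2).
Proof.
move=> CF im tT F0.
have [Hs_ En] := @classical_Hs _ (fun j => dtx T i j F t) n
  (fun j jn => rect_continuous_slice (C_tx_rect CF im jn) tT)
  (fun j jn => C_tx_dx CF im jn tT).
split; last exact: En.
rewrite /HH; split; [exact: Hs_|exact: rect_continuous_slice (C_tx_rect CF im (leq0n n))
  tT|exact: F0].
Qed.

Lemma sum_sqr_L2norm_continuous T m n F i : C_tx T m n F -> (i <= m)%N ->
  {within `[0, T], continuous (fun t => \sum_(l < n.+1) L2norm (dtx T i l F t) ^+ 2)}.
Proof.
move=> CF im; have H l : (l <= n)%N -> {within `[0, T], continuous (fun t => L2norm (dtx T i l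
  F t) ^+ 2)}.
  move=> ln t; have c := rect_L2norm_continuous (C_tx_rect CF im ln).
  by apply: cvgM; exact: c.
suff G k : (k <= n.+1)%N -> {within `[0, T], continuous (fun t => \sum_(l < k) L2norm (dtx T i
  l F t) ^+ 2)}.
  exact: G (leqnn _).
elim: k => [_|k IH kn].
  rewrite (_ : (fun t => _) = fun=> 0); last by apply/funext => t; rewrite big_ord0.
  by move=> t; exact: cvg_cst.
rewrite (_ : (fun t => _) = fun t => \sum_(l < k) L2norm (dtx T i l F t) ^+ 2 + L2norm (dtx T i
  k F t) ^+ 2); last first.
  by apply/funext => t; rewrite big_ord_recr.
by move=> t; apply: cvgD; [exact: IH (ltnW kn) t|exact: H kn t].
Qed.

Lemma Gamma_D_continuous T r u : C_tx T 1 r.+1 u -> 0 < T ->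
  (forall t, t \in `[0, T] -> u t 0 = 0) ->
  {within `[0, T], continuous (Gamma_D T r u)}.
Proof.
move=> Cu T0 u0.
pose g t := (\sum_(l < r.+2) L2norm (dtx T 0 l u t) ^+ 2) + \sum_(l < r.+2) L2norm (dtx T 1 l u
  t) ^+ 2.
have cg : {within `[0, T], continuous g}.
  move=> t; apply: cvgD.
    exact: (sum_sqr_L2norm_continuous Cu (leq0n 1)).
  exact: (sum_sqr_L2norm_continuous Cu (leqnn 1)).
have e : {in `[0, T]%classic, g =1 Gamma_D T r u}.
  move=> t; rewrite inE => tT; rewrite /g /Gamma_D.
  have z01 : (0 : R) \in `[0, 1] by rewrite in_itv/= lexx ler01.
  have [_ E0] := HH_dtx Cu (leq0n 1) tT (u0 t tT).
  have [_ E1] := HH_dtx Cu (leqnn 1) tT (dt_vanish Cu (leqnn 1) T0 z01 u0 tT).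
  rewrite -[u t]/(dtx T 0 0 u t) -[dt T u t]/(dtx T 1 0 u t) E0 E1.
  by rewrite !sqr_sqrtr// sumr_ge0// => l _; exact: sqr_ge0.
exact: (@subspace_eq_continuous _ _ _ g (Gamma_D T r u) e cg).
Qed.

Lemma Gamma_D_ge0 T r u t : 0 <= Gamma_D T r u t.
Proof. by rewrite addr_ge0 ?sqr_ge0. Qed.

(** Multiply the equation by chi and integrate by parts; the boundary term
    a u_x(1) chi(1) is replaced by the dynamical boundary condition. *)
Lemma weak_solution T m n beta f delta g eps a (u0 : R -> R) u t chi :
  C_tx T m n u -> (0 < m)%N -> (1 < n)%N -> smooth_tx T beta -> smooth_tx T f ->
  solves_P T beta f delta g eps a u0 u -> t \in `[0, T] -> HH 1 chi ->
  ip (dt T u t) chi =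
    (eps t * dt T u t 1 + delta t * u t 1 + g t) * chi 1 - a t * B (u t) chi
    + ip (fun x => beta t x * u t x) chi + ip (f t) chi.
Proof.
move=> Cu m0 n1 sb sf [pde _ bc _] tT Hchi.
have c0 := rect_continuous_slice (C_tx_rect Cu (leq0n m) (leq0n n)) tT.
have cb := rect_continuous_slice (C_tx_rect (sb 0%N 0%N) (leq0n 0) (leq0n 0)) tT.
have cf := rect_continuous_slice (C_tx_rect (sf 0%N 0%N) (leq0n 0) (leq0n 0)) tT.
have d1 := C_tx_dx Cu (leq0n m) (ltnW n1) tT.
have d2 := C_tx_dx Cu (leq0n m) n1 tT.
have [_ c2 _] := d2; have [_ c1 _] := d1.
have Lchi := HH1_L2 Hchi.
have L2u := L2_continuous c2.
have Lbu : L2 (fun x => beta t x * u t x).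
  by apply: L2_continuous => x; apply: cvgM; [exact: cb|exact: c0].
have Lf := L2_continuous cf.
have e1 : ip (dt T u t) chi = ip ((fun x => a t * dtx T 0 2 u t x + beta t x * u t x) \+ f t) chi.
  by apply: eq_ip => // x; rewrite inE => /D01_cc x01; rewrite pde.
rewrite e1 ipDl; [|exact: L2_lin|exact: Lf|exact: Lchi].
rewrite ip_linl; [|exact: L2u|exact: Lbu|exact: Lchi].
have e2 : ip (dtx T 0 2 u t) chi = dx u t 1 * chi 1 - B (u t) chi.
  rewrite ipC (weak_ibp (HH1_cont Hchi) (HH1_weak Hchi) d2) (HH1_0 Hchi) mul0r subr0 mulrC.
  rewrite B_sym; congr (_ - _); apply: ae_eq_ip.
  - exact: wderiv_L2.
  - exact: wderiv_L2.
  - exact: L2_continuous.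
  - exact: wderiv_L2.
  - exact: ae_eq_refl.
  - by apply: ae_eq_sym; exact: wderiv_ae (C1_deriv_weak d1).
by rewrite e2 -bc//; ring.
Qed.

End DataBounds.

(** * Differentiable paths in the energy space *)

Section EnergyPaths.
Variable R : realType.
Implicit Types (x t s T e : R) (V : set (R -> R)).

Lemma energy_derivativeP T w w' t : energy_derivative T w w' t <->
  forall e, 0 < e -> exists2 r, 0 < r & forall s, `|t - s| < r -> s != t -> s \in `[0, T] ->
    energy_norm (fun x => (w s x - w t x) / (s - t) - w' t x) <= e.
Proof.
split=> [/cvgrPdist_le H e e0|H].
  have [r /= r0 Hr] := H _ e0; exists r; first exact: r0.
  move=> s sr st sT; have := Hr s sr st sT.
  by rewrite sub0r normrN (ger0_norm (energy_norm_ge0 _)).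
apply/cvgrPdist_le => e e0; have [r r0 Hr] := H _ e0.
exists r; first exact: r0.
move=> s /= sr st sT; rewrite sub0r normrN (ger0_norm (energy_norm_ge0 _)).
exact: Hr.
Qed.

(** The error of the difference quotient of u has the classical x-derivative
    given by the error of the difference quotient of u_x, which tends to 0
    uniformly in x. *)
Lemma C_tx_energy_derivative T m n u t : C_tx T m n u -> (0 < m)%N -> (0 < n)%N ->
  t \in `[0, T] -> energy_derivative T u (dt T u) t.
Proof.
move=> Cu m0 n0 tT; apply/energy_derivativeP => e e0.
have [r r0 Hr] := diff_quot_uniform (C_tx_rect Cu m0 n0)
  (fun s x sT x01 => C_tx_dt Cu m0 n0 sT x01) tT e0.
exists r; first exact: r0.
move=> s sr st sT.
have ds := C_tx_dx Cu (leq0n m) n0 sT; have d0 := C_tx_dx Cu (leq0n m) n0 tT.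
have d' := C_tx_dx Cu m0 n0 tT.
have H := C1_deriv_lin (s - t)^-1 ds (C1_deriv_lin (- (s - t)^-1) d0 (C1_deriv_lin (-1) d'
  (C1_deriv_cst 0))).
have -> : (fun x => (u s x - u t x) / (s - t) - dt T u t x) =
   fun x => (s - t)^-1 * dtx T 0 0 u s x + (- (s - t)^-1 * dtx T 0 0 u t x + (-1 * dtx T 1 0 u
     t x + 0)).
  by apply/funext => x; rewrite /dtx /=; ring.
rewrite (C1_deriv_energy H); have [_ cH _] := H.
apply: L2norm_le_bound; [exact: ltW|exact: L2_continuous|].
move=> x /D01_cc x01; rewrite (_ : _ + _ = (dtx T 0 1 u s x - dtx T 0 1 u t x) / (s - t) - dtx
  T 1 1 u t x); last by ring.
exact: Hr.
Qed.

(** The elliptic projection is linear and does not increase the energy, so it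
    maps difference quotients to difference quotients and preserves their
    convergence. *)
Lemma projection_energy_derivative T V u u' p q t :
  finite_dim_subspace V -> V `<=` HH 1 ->
  (forall s, s \in `[0, T] -> HH 1 (u s)) -> HH 1 (u' t) -> t \in `[0, T] ->
  (forall s, s \in `[0, T] -> is_elliptic_projection V (u s) (p s)) ->
  is_elliptic_projection V (u' t) (q t) ->
  energy_derivative T u u' t -> energy_derivative T p q t.
Proof.
move=> fV VH Hu Hu' tT Pp Pq du.
apply/energy_derivativeP => e e0.
have [r r0 Hr] := (energy_derivativeP _ _ _ _).1 du e e0.
exists r; first exact: r0.
move=> s sr st sT; apply: le_trans (Hr s sr st sT).
have [Vps ps] := Pp s sT; have [Vpt pt] := Pp t tT; have [Vqt qt] := Pq.
have Hps := VH _ Vps; have Hpt := VH _ Vpt; have Hqt := VH _ Vqt.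
have Hus := Hu s sT; have Hut := Hu t tT.
pose Dq := fun x => (p s x - p t x) / (s - t) - q t x.
pose Eq := fun x => (u s x - u t x) / (s - t) - u' t x.
have quotE (w1 w2 w3 : R -> R) : (fun x => (w1 x - w2 x) / (s - t) - w3 x) =
    fun x => (s - t)^-1 * (w1 \- w2) x + (-1 * w3 x + 0).
  by apply/funext => x /=; ring.
have Bq w1 w2 w3 z : HH 1 w1 -> HH 1 w2 -> HH 1 w3 ->
    B (fun x => (w1 x - w2 x) / (s - t) - w3 x) z = (s - t)^-1 * (B w1 z - B w2 z) - B w3 z.
  move=> h1 h2 h3; rewrite quotE (B_lin _ _ (HH1B h1 h2) (HH1_lin (-1) h3 (HH1_null R))).
  by rewrite (B_Bl _ h1 h2) (B_lin _ _ h3 (HH1_null R)) B_0l addr0 mulN1r.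
have VD : V Dq.
  have V0 := finite_dim_B fV Vqt Vqt.
  have := finite_dim_lin (s - t)^-1 fV (finite_dim_B fV Vps Vpt) (finite_dim_lin (-1) fV Vqt V0).
  rewrite (_ : (fun x => _) = Dq)//; apply/funext => x; rewrite /Dq /=; ring.
have E : B Dq Dq = B Eq Dq.
  by rewrite /Dq /Eq (Bq _ _ _ _ Hps Hpt Hqt) (Bq _ _ _ _ Hus Hut Hu') (ps _ VD) (pt _ VD) (qt
    _ VD).
have sq : energy_norm Dq ^+ 2 <= energy_norm Eq * energy_norm Dq.
  by rewrite sqr_energy_norm E; exact: B_le.
have [n0|n0] := eqVneq (energy_norm Dq) 0.
  by rewrite -/Dq n0; exact: energy_norm_ge0.
have np : 0 < energy_norm Dq by rewrite lt_neqAle eq_sym n0; exact: energy_norm_ge0.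
by move: sq; rewrite expr2 (ler_pM2r np).
Qed.

Lemma energy_derivativeB T (w w' p q : R -> R -> R) t :
  (forall s, s \in `[0, T] -> HH 1 (w s) /\ HH 1 (p s)) ->
  HH 1 (w' t) -> HH 1 (q t) -> t \in `[0, T] ->
  energy_derivative T w w' t -> energy_derivative T p q t ->
  energy_derivative T (fun s => w s \- p s) (fun s => w' s \- q s) t.
Proof.
move=> HHwp Hw' Hq tT dw dp.
apply/energy_derivativeP => e e0; have e2 : 0 < e / 2 by rewrite divr_gt0.
have [r1 r10 Hr1] := (energy_derivativeP _ _ _ _).1 dw _ e2.
have [r2 r20 Hr2] := (energy_derivativeP _ _ _ _).1 dp _ e2.
exists (Num.min r1 r2); first by rewrite lt_min r10 r20.
move=> s; rewrite lt_min => /andP[sr1 sr2] st sT.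
rewrite [e]splitr; apply: le_trans (lerD (Hr1 s sr1 st sT) (Hr2 s sr2 st sT)).
have [Hws Hps] := HHwp s sT; have [Hwt Hpt] := HHwp t tT.
have -> : (fun x => ((w s \- p s) x - (w t \- p t) x) / (s - t) - (w' t \- q t) x) =
    (fun x => (w s x - w t x) / (s - t) - w' t x) \- (fun x => (p s x - p t x) / (s - t) - q t x).
  by apply/funext => x /=; ring.
by apply: energy_normB; apply: HH1_diff_quot.
Qed.

Lemma C1_path_energy_derivative T V w w' t : C1_path T V w w' -> t \in `[0, T] ->
  energy_derivative T w w' t.
Proof.
move=> /(_ t)/[apply] -[_ dw _].
apply/energy_derivativeP => e e0; move/cvgrPdist_le : dw => /(_ e e0)[r /= r0 Hr].
exists r; first exact: r0.
move=> s sr st sT; have := Hr s sr st sT.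
rewrite sub0r normrN (ger0_norm (Hnorm_ge0 _ _)).
by apply: le_trans; exact: energy_le_Hnorm1.
Qed.

End EnergyPaths.

(** * The error estimate *)

Section ErrorSplitting.
Variable R : realType.
Implicit Types (v w : R -> R) (x t s T e h : R) (V : set (R -> R)).

(** Both the discrete initial value and the projection of u 0 are projections
    of the same function, so that their difference is B-orthogonal to V, hence
    to itself. *)
Lemma same_projection V u0 (u : R -> R -> R) w0 p0 : finite_dim_subspace V -> V `<=` HH 1 ->
  (forall x, x \in `[0, 1] -> u 0 x = u0 x) ->
  is_elliptic_projection V u0 w0 -> is_elliptic_projection V (u 0) p0 ->
  energy_norm (w0 \- p0) = 0 :> R.
Proof.
move=> fV VH ic [Vw wE] [Vp pE].
have Vd := finite_dim_B fV Vw Vp.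
apply/eqP; rewrite -sqrf_eq0 sqr_energy_norm (B_Bl _ (VH _ Vw) (VH _ Vp)) (wE _ Vd) (pE _ Vd).
rewrite subr_eq0; apply/eqP; apply: B_eq => x //.
by rewrite inE => /D01_cc x01; rewrite ic.
Qed.

(** Subtract the two weak equations tested with theta'. The orthogonality of
    eta removes its energy term, and its vanishing at 1 removes its boundary
    terms. *)
Lemma error_equation T beta f delta g eps a (u w w' p q : R -> R -> R) u0 V t m n :
  C_tx T m n u -> (0 < m)%N -> (1 < n)%N -> smooth_tx T beta -> smooth_tx T f ->
  solves_P T beta f delta g eps a u0 u -> t \in `[0, T] ->
  finite_dim_subspace V -> V `<=` HH 1 -> V id ->
  HH 1 (u t) -> HH 1 (dt T u t) ->
  V (w t) -> V (w' t) ->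
  is_elliptic_projection V (u t) (p t) -> is_elliptic_projection V (dt T u t) (q t) ->
  (forall chi, V chi -> ip (w' t) chi =
     (eps t * w' t 1 + delta t * w t 1 + g t) * chi 1
     - a t * B (w t) chi + ip (fun x => beta t x * w t x) chi + ip (f t) chi) ->
  let theta := w t \- p t in let theta' := w' t \- q t in
  let eta := p t \- u t in let eta' := q t \- dt T u t in
  ip theta' theta' + ip eta' theta' =
    (eps t * theta' 1 + delta t * theta 1) * theta' 1 - a t * B theta theta'
    + ip (fun x => beta t x * theta x) theta' + ip (fun x => beta t x * eta x) theta'.
Proof.
move=> Cu m0 n1 sb sf sol tT fV VH Vid Hu Hu' Vw Vw' Pp Pq weak.
have [Vp pE] := Pp; have [Vq qE] := Pq.
have Hw := VH _ Vw; have Hw' := VH _ Vw'; have Hp := VH _ Vp; have Hq := VH _ Vq.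
have Vchi : V (w' t \- q t) := finite_dim_B fV Vw' Vq.
move=> theta theta' eta eta'.
have Hchi := VH _ Vchi; have Lchi := HH1_L2 Hchi.
have e1 := weak _ Vchi.
have e2 := weak_solution Cu m0 n1 sb sf sol tT Hchi.
have p1 := elliptic_projection_endpoint VH Vid Hu Pp.
have q1 := elliptic_projection_endpoint VH Vid Hu' Pq.
rewrite -/theta' in e1 e2 Hchi Lchi Vchi.
have cb := rect_continuous_slice (C_tx_rect (sb 0%N 0%N) (leq0n 0) (leq0n 0)) tT.
have Lb v : HH 1 v -> L2 (fun x => beta t x * v x).
  move=> Hv; apply: L2_continuous => x; apply: cvgM; first exact: cb.
  by have c := HH1_cont Hv; exact: c.
have r1 : ip theta' theta' + ip eta' theta' = ip (w' t) theta' - ip (dt T u t) theta'.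
  rewrite {1}/theta' (ipBl (HH1_L2 Hw') (HH1_L2 Hq) Lchi).
  by rewrite /eta' (ipBl (HH1_L2 Hq) (HH1_L2 Hu') Lchi) addrA subrK.
have r2 : B theta theta' = B (w t) theta' - B (u t) theta'.
  by rewrite /theta (B_Bl _ Hw Hp) (pE _ Vchi).
have r3 : ip (fun x => beta t x * theta x) theta' + ip (fun x => beta t x * eta x) theta' =
    ip (fun x => beta t x * w t x) theta' - ip (fun x => beta t x * u t x) theta'.
  have -> : (fun x => beta t x * theta x) = (fun x => beta t x * w t x) \- (fun x => beta t x *
    p t x).
    by apply/funext => x; rewrite /theta /=; ring.
  have -> : (fun x => beta t x * eta x) = (fun x => beta t x * p t x) \- (fun x => beta t x * u
    t x).
    by apply/funext => x; rewrite /eta /=; ring.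
  by rewrite (ipBl (Lb _ Hw) (Lb _ Hp) Lchi) (ipBl (Lb _ Hp) (Lb _ Hu) Lchi) addrA subrK.
have r4 : theta' 1 = w' t 1 - dt T u t 1 by rewrite /theta' /= q1.
have r5 : theta 1 = w t 1 - u t 1 by rewrite /theta /= p1.
rewrite -addrA r3 r1 e1 e2 r2 r5.
have -> : eps t * theta' 1 = eps t * w' t 1 - eps t * dt T u t 1 by rewrite r4 mulrBr.
move: (theta' 1) (w' t 1) (dt T u t 1) (w t 1) (u t 1) (B (w t) theta') (B (u t) theta').
move: (ip (fun x => beta t x * w t x) theta') (ip (fun x => beta t x * u t x) theta').
move: (ip (f t) theta') => *.
by ring.
Qed.

Lemma error_arith (lt le_ nt ne U J D4 hr h hs C : R) :
  0 <= hs -> 0 <= U -> 0 <= J -> 0 <= D4 -> 0 <= hr -> 0 <= C ->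
  lt <= nt -> h * nt <= hs * nt -> nt <= D4 * hr * J ->
  le_ <= C * hr * U -> h * ne <= C * hr * U ->
  lt + le_ + h * (2 * (nt + ne)) <= ((1 + 2 * hs) * D4 + 3 * C) * hr * (U + J).
Proof.
move=> hs0 U0 J0 D0 hr0 C0 n3 n5 th b1 b2.
have x0 : hs * nt <= hs * (D4 * hr * J) by apply: ler_wpM2l.
have y1 : 0 <= (1 + 2 * hs) * D4 * hr * U.
  by rewrite !mulr_ge0// addr_ge0// mulr_ge0.
have y2 : 0 <= 3 * C * hr * J by rewrite !mulr_ge0.
lra.
Qed.

End ErrorSplitting.

Theorem theorem4p3 (R : realType)
    (r : nat) (hstar : R) (S : R -> set (R -> R))
    (T : R) (beta f : R -> R -> R) (delta g eps a u0 : R -> R)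
    (u : R -> R -> R) (uh : R -> R -> R -> R)
    (r_gt0 : (0 < r)%N) (hstar_gt0 : 0 < hstar)
    (S_fe : fe_family r hstar S)
    (data : data_P T beta f delta g eps a u0)
    (u_smooth : C_tx T 1 r.+1 u)
    (u_sol : solves_P T beta f delta g eps a u0 u)
    (uh_sol : forall h, 0 < h <= hstar ->
       semidiscrete_solution T beta f delta g eps a u0 (S h) (uh h))
    (eps_le0 : forall t, t \in `[0, T] -> eps t <= 0) :
  exists C : R, forall h, 0 < h <= hstar -> forall t, t \in `[0, T] ->
    L2norm (uh h t \- u t) + h * Hnorm 1 (uh h t \- u t) <=
      C * h ^+ r.+1 *
        (Hnorm r.+1 (u t) +
         Num.sqrt (\int[@lebesgue_measure R]_(tau in `[0, t]) Gamma_D T r u tau)).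
Proof.
have [T0 [sb sf] [sd _ _] [sa a_gt0 inf_gt0] _] := data.
have [_ ubc _ uic] := u_sol.
have T0' := ltW T0.
have z01 : (0 : R) \in `[0, 1] by rewrite in_itv/= lexx ler01.
have [ca cda da] := smooth_onP sa.
have [cdl cddl ddl] := smooth_onP sd.
pose a0 := inf [set a t | t in `[0, T]].
have a0_le t : t \in `[0, T] -> a0 <= a t.
  move=> tT; apply: ge_inf; last by exists t.
  by exists 0 => _ [s sT <-]; apply: ltW; exact: a_gt0.
have [M1 M1p hM1] := segment_bounded T0' cda.
have [M2 M2p hM2] := segment_bounded T0' cdl.
have [M3 M3p hM3] := segment_bounded T0' cddl.
have [M4 M4p hM4] := rect_bounded (C_tx_rect (sb 0%N 0%N) (leq0n 0) (leq0n 0)).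
pose M := M1 + M2 + M3 + M4.
have Mp : 0 <= M by rewrite /M; lra.
(* This weight makes M times the energy part of the trace at most a0 / 2. *)
have e0 : 0 < a0 / (2 * (M + 1)) by rewrite divr_gt0//; lra.
have [K0 K0p trace0] := trace_interpolation e0.
have trace v : HH 1 v -> M * v 1 ^+ 2 <= a0 / 2 * energy_norm v ^+ 2 + M * K0 * L2norm v ^+ 2.
  move=> Hv; apply: le_trans (ler_wpM2l Mp (trace0 v Hv)) _.
  rewrite mulrDr -[M * K0 * _]mulrA lerD2r mulrA; apply: ler_wpM2r; first exact: sqr_ge0.
  rewrite (_ : M * (a0 / (2 * (M + 1))) = a0 / 2 * (M / (M + 1))); last by field; lra.
  rewrite -[leRHS]mulr1; apply: ler_wpM2l; first by rewrite divr_ge0// ltW.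
  by rewrite ler_pdivrMr; lra.
have [Cp Cp0 PE] := projection_error r_gt0 S_fe.
have Hu t : t \in `[0, T] -> HH r.+1 (u t).
  by move=> tT; have [] := HH_dtx u_smooth (leq0n 1) tT (ubc t tT).
have Hu' t : t \in `[0, T] -> HH r.+1 (dt T u t).
  move=> tT; have z := dt_vanish u_smooth (leqnn 1) T0 z01 ubc tT.
  by have [] := HH_dtx u_smooth (leqnn 1) tT z.
have cG := Gamma_D_continuous u_smooth T0 ubc.
pose c := 2 / a0 * (2 * M + 2 * (M * K0 + M) ^+ 2).
(* The constants of energy_estimate and of projection_error. *)
pose C4 := 2 / a0 * (expR (c * T) * (2 * (M ^+ 2 + 1))) * Cp ^+ 2.
have C4p : 0 <= C4.
  apply: mulr_ge0; last exact: sqr_ge0.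
  apply: mulr_ge0; first by rewrite divr_ge0// ltW.
  by rewrite mulr_ge0 ?expR_ge0// mulr_ge0// addr_ge0 ?sqr_ge0.
exists ((1 + 2 * hstar) * Num.sqrt C4 + 3 * Cp) => h hh t tT.
have /andP[h0 hle] := hh.
have [fV VH _ Vid] := S_fe.1 h hh.
have [w' [path init weak]] := uh_sol h hh.
have [P PP] := choice (fun v => elliptic_projection_exists v fV VH).
pose p s := P (u s); pose q s := P (dt T u s).
have hr0 : 0 <= h ^+ r.+1 by rewrite exprn_ge0// ltW.
have Hu1 s : s \in `[0, T] -> HH 1 (u s) by move=> sT; exact: HH_HH1 (ltn0Sn r) (Hu s sT).
have Hu1' s : s \in `[0, T] -> HH 1 (dt T u s) by move=> sT; exact: HH_HH1 (ltn0Sn r) (Hu' s sT).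
have HHV v : HH 1 (P v) by have [Vp _] := PP v; exact: VH.
have HHw s : s \in `[0, T] -> HH 1 (uh h s) /\ HH 1 (w' s).
  by move=> sT; have [[Vw Vw'] _ _] := path s sT; split; exact: VH.
have est s : s \in `[0, T] ->
    a0 / 2 * energy_norm (uh h s \- p s) ^+ 2 <=
      expR (c * T) * (2 * (M ^+ 2 + 1) * (Cp * h ^+ r.+1) ^+ 2) *
      \int[@lebesgue_measure R]_(tau in `[0, s]) Gamma_D T r u tau.
  apply: (@energy_estimate R T a (derive_in `[0, T] a) delta (derive_in `[0, T] delta) eps beta
    (fun s => uh h s \- p s) (fun s => w' s \- q s) (fun s => p s \- u s) (fun s => q s \- dt T
      u s)).
  - exact: T0'.
  - exact: inf_gt0.
  - exact: Mp.
  - exact: mulr_ge0.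
  - exact: sqr_ge0.
  - exact: trace.
  - move=> z zT; have := hM1 z zT; have := hM2 z zT; have := hM3 z zT => m3 m2 m1.
    split; [exact: a0_le|apply: le_trans m1 _|apply: le_trans m2 _|apply: le_trans m3 _
      |exact: eps_le0]; rewrite /M; lra.
  - exact: da.
  - exact: ddl.
  - move=> z zT; split.
      exact: rect_continuous_slice (C_tx_rect (sb 0%N 0%N) (leq0n 0) (leq0n 0)) zT.
    by move=> x x01; apply: le_trans (hM4 z x zT x01) _; rewrite /M; lra.
  - move=> z zT; have [hw hw'] := HHw z zT; split; apply: HH1B;
    [exact: hw|exact: HHV|exact: hw'|exact: HHV|exact: HHV|exact: Hu1|exact: HHV|exact: Hu1'].
  - move=> z zT; apply: energy_derivativeB.
    + by move=> y yT; split; [have [] := HHw y yT|exact: HHV].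
    + by have [] := HHw z zT.
    + exact: HHV.
    + exact: zT.
    + exact: C1_path_energy_derivative path zT.
    + refine (projection_energy_derivative fV VH Hu1 (Hu1' z zT) zT (fun y _ => PP (u y))
        (PP (dt T u z)) _).
      exact: (C_tx_energy_derivative u_smooth (leqnn 1) (ltn0Sn r) zT).
  - exact: (same_projection fV VH uic init (PP _)).
  - move=> z zT; have [[Vw Vw'] _ _] := path z zT.
    by apply: (error_equation u_smooth (leqnn 1) _ sb sf u_sol zT fV VH Vid (Hu1 z zT) (Hu1' z
      zT) Vw Vw' (PP _) (PP _)) => // chi Vchi; exact: weak.
  - exact: cG.
  - move=> z zT; split; last exact: Gamma_D_ge0.
    have [b1 _] := PE h (u z) (p z) hh (Hu z zT) (PP _).
    have [b2 _] := PE h (dt T u z) (q z) hh (Hu' z zT) (PP _).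
    rewrite /Gamma_D mulrDr -!exprMn.
    have le_sqr (x y : R) : 0 <= x -> x <= y -> x ^+ 2 <= y ^+ 2.
      by move=> x0 xy; rewrite lerXn2r// nnegrE// (le_trans x0).
    exact: (lerD (le_sqr _ _ (L2norm_ge0 _) b1) (le_sqr _ _ (L2norm_ge0 _) b2)).
have {}est := est t tT.
set I := \int[_]_(_ in _) _ in est *.
have I0 : 0 <= I.
  by apply: Rintegral_ge0 => x _; exact: Gamma_D_ge0.
have [hw _] := HHw t tT.
have Hth : HH 1 (uh h t \- p t) by apply: HH1B; [exact: hw|exact: HHV].
have Het : HH 1 (p t \- u t) by apply: HH1B; [exact: HHV|exact: Hu1].
have th : energy_norm (uh h t \- p t) <= Num.sqrt C4 * h ^+ r.+1 * Num.sqrt I.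
  have E : energy_norm (uh h t \- p t) ^+ 2 <= C4 * (h ^+ r.+1) ^+ 2 * I.
    have a2 : 0 < a0 / 2 by rewrite divr_gt0.
    rewrite -(@ler_pM2l _ (a0 / 2))//; apply: le_trans est _.
    rewrite le_eqVlt; apply/orP; left; apply/eqP; rewrite /C4.
    by field; rewrite gt_eqF.
  rewrite -[leLHS]ger0_norm ?energy_norm_ge0// -sqrtr_sqr.
  have -> : Num.sqrt C4 * h ^+ r.+1 * Num.sqrt I = Num.sqrt (C4 * (h ^+ r.+1) ^+ 2 * I).
    by rewrite (sqrtrM I (mulr_ge0 C4p (sqr_ge0 _))) (sqrtrM _ C4p) sqrtr_sqr ger0_norm.
  by rewrite (ler_sqrt _ (mulr_ge0 (mulr_ge0 C4p (sqr_ge0 _)) I0)).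
have [b1 b2] := PE h (u t) (p t) hh (Hu t tT) (PP _).
have eE : uh h t \- u t = (uh h t \- p t) \+ (p t \- u t).
  by apply/funext => x /=; rewrite addrA subrK.
rewrite eE.
have n1 := L2normD (HH1_L2 Hth) (HH1_L2 Het).
have n2 := le_trans (Hnorm1_le (HH1D Hth Het)) (ler_wpM2l (ler0n R 2) (energy_normD Hth Het)).
have n3 := poincare Hth.
have n4 := ler_wpM2l (ltW h0) n2.
have n5 : h * energy_norm (uh h t \- p t) <= hstar * energy_norm (uh h t \- p t).
  by apply: ler_wpM2r; [exact: energy_norm_ge0|exact: hle].
have U0 := Hnorm_ge0 r.+1 (u t).
apply: le_trans (lerD n1 n4) _.
exact: (error_arith (ltW hstar_gt0) U0 (sqrtr_ge0 _) (sqrtr_ge0 _) hr0 Cp0 n3 n5 th b1 b2).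
Qed.
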